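(* Let $E$ be a field of characteristic different from $2$. If $E$ is finite or pseudo-algebraically closed, then $E$ is square-reflexive.
   Context: $E$ is pseudo-algebraically closed if every absolutely irreducible curve over $E$ has an $E$-rational point. Square-reflexivity. For a commutative ring $R$ let $R^\times$ be its group of units and $R^{\times 2}=\{x^2\mid x\in R^\times\}$; an element of $R$ is square-free if it is not equal to $x^2y$ for any $x\in R\setminus R^\times$ and $y\in R$. For a nonzero $f\in E[X]$ put $E_f=E[X]/(f)$, let $\mathrm{N}_{E_f/E}:E_f\to E$ be the norm of this finite-dimensional $E$-algebra and let $\mathrm{lc}(f)$ be the leading coefficient of $f$. A square-free polynomial $f\in E[X]\setminus\{0\}$ is called square-reflexive if for every $\alpha\in E_f^\times$ with $\mathrm{N}_{E_f/E}(\alpha)\in E^{\times 2}\cup \mathrm{lc}(f)E^{\times 2}$ there exists a polynomial $g\in E[X]$ coprime to $f$ such that $g+(f)\in\alpha E_f^{\times 2}$ and $f+(g)\in E_g^{\times 2}$. The field $E$ is called square-reflexive if every square-free polynomial in $E[X]$ is square-reflexive. *)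

(* Defs.v *)
From HB Require Import structures.
From mathcomp Require Import all_boot all_order all_algebra.
From mathcomp Require Export mpoly.

Set Implicit Arguments.
Unset Strict Implicit.
Unset Printing Implicit Defensive.

Import GRing.Theory.
Local Open Scope ring_scope.

(* A [comPzRingType] may be the zero ring, in which 0 is a unit; this is needed
   for E[X]/(f) with f constant. *)
Section CommutativeRings.
Variable R : comPzRingType.

Definition is_unit (x : R) : Prop := exists y, x * y = 1.

Definition unit_square (x : R) : Prop := exists2 y, is_unit y & x = y ^+ 2.

Definition square_free (z : R) : Prop :=
  forall x y : R, z = x ^+ 2 * y -> is_unit x.

End CommutativeRings.

(* E[X]/(f) for f nonzero, possibly constant or non-monic (the library's
   {poly %/ f} requires f to be monic of positive degree): a residue class is
   its representative of degree < deg f.  For f = 0 the type is the zero ring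
   instead of E[X], so it must only be used for f != 0. *)
Definition polyquot (E : fieldType) (f : {poly E}) : Type :=
  {poly_(size f).-1 E}.

Section PolyQuotient.
Variables (E : fieldType) (f : {poly E}).
Implicit Types (p q : {poly E}) (x y z : polyquot f).

HB.instance Definition _ := Vector.on (polyquot f).

Definition quot_rep x : {poly E} := qpoly.polyn x.
Definition to_quot p : polyquot f := npolyp (size f).-1 (p %% f).

Lemma quot_rep_inj : injective quot_rep.
Proof. exact: val_inj. Qed.

Lemma quot_rep_linear : linear quot_rep.
Proof. by []. Qed.

Lemma to_quotK p : f != 0 -> quot_rep (to_quot p) = p %% f.
Proof.
move=> f0; rewrite /quot_rep /to_quot npolypK // -ltnS prednK ?size_poly_gt0 //.
exact: ltn_modpN0.
Qed.

Lemma polyquot0_eq x y : f = 0 -> x = y.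
Proof.
move=> f0; apply: quot_rep_inj.
have z0 (z : polyquot f) : quot_rep z = 0.
  apply/eqP; rewrite -size_poly_eq0 -leqn0.
  by rewrite (leq_trans (size_npoly z)) ?f0 ?size_poly0.
by rewrite !z0.
Qed.

Lemma quot_repK : cancel quot_rep to_quot.
Proof.
move=> x; have [f0|f0] := eqVneq f 0; first exact: polyquot0_eq.
apply: quot_rep_inj; rewrite to_quotK // modp_small //.
by rewrite -[X in (_ < X)%N]prednK ?size_poly_gt0 // ltnS; apply: size_npoly.
Qed.

Lemma to_quot_linear : linear to_quot.
Proof.
move=> a p q; have [f0|f0] := eqVneq f 0; first exact: polyquot0_eq.
apply: quot_rep_inj.
by rewrite quot_rep_linear !to_quotK // modpD modpZl.
Qed.

HB.instance Definition _ :=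
  GRing.isSemilinear.Build E {poly E} (polyquot f) _ to_quot
    (GRing.semilinear_linear to_quot_linear).

Definition quot_mul x y : polyquot f := to_quot (quot_rep x * quot_rep y).

Lemma quot_mul_to p q : quot_mul (to_quot p) (to_quot q) = to_quot (p * q).
Proof.
have [f0|f0] := eqVneq f 0; first exact: polyquot0_eq.
apply: quot_rep_inj; rewrite /quot_mul !to_quotK //.
by rewrite modp_mul mulrC modp_mul mulrC.
Qed.

Lemma quot_mulA : associative quot_mul.
Proof.
move=> x y z; rewrite -[x]quot_repK -[y]quot_repK -[z]quot_repK.
by rewrite !quot_mul_to mulrA.
Qed.

Lemma quot_mulC : commutative quot_mul.
Proof. by move=> x y; rewrite /quot_mul mulrC. Qed.

Lemma quot_mul1 : left_id (to_quot 1) quot_mul.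
Proof. by move=> x; rewrite -[x]quot_repK quot_mul_to mul1r. Qed.

Lemma quot_mulDl : left_distributive quot_mul +%R.
Proof.
move=> x y z; rewrite -[x]quot_repK -[y]quot_repK -[z]quot_repK.
by rewrite -linearD !quot_mul_to mulrDl linearD.
Qed.

HB.instance Definition _ := GRing.Zmodule_isComPzRing.Build (polyquot f)
  quot_mulA quot_mulC quot_mul1 quot_mulDl.

Lemma to_quot_monoid_morphism : monoid_morphism to_quot.
Proof. by split=> // p q; rewrite -quot_mul_to. Qed.

HB.instance Definition _ :=
  GRing.isMonoidMorphism.Build {poly E} (polyquot f) to_quot
    to_quot_monoid_morphism.

Lemma to_quot_surj x : exists p, to_quot p = x.
Proof. by exists (quot_rep x); apply: quot_repK. Qed.

Lemma to_quot_eq0 p : f != 0 -> (to_quot p == 0) = (f %| p).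
Proof.
move=> f0; rewrite -(inj_eq quot_rep_inj) to_quotK //.
Qed.

Lemma quot_mul_linear x : linear (quot_mul x).
Proof.
by move=> a y z; rewrite /quot_mul quot_rep_linear mulrDr -scalerAr linearP.
Qed.

HB.instance Definition _ x :=
  GRing.isSemilinear.Build E (polyquot f) (polyquot f) _ (quot_mul x)
    (GRing.semilinear_linear (quot_mul_linear x)).

(* [quot_mul x] is y |-> x * y; the determinant of the empty matrix being 1,
   the norm is 1 when f is constant. *)
Definition quot_norm x : E :=
  \det (passmx.mxof (vbasis fullv) (vbasis fullv) (linfun (quot_mul x))).

End PolyQuotient.

Section SquareReflexive.
Variable E : fieldType.
Implicit Types f : {poly E}.

Definition square_reflexive_poly f : Prop :=
  forall alpha : polyquot f, is_unit alpha ->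
    unit_square (quot_norm alpha) \/
      (exists2 c : E, unit_square c & quot_norm alpha = lead_coef f * c) ->
  exists g : {poly E},
    [/\ g != 0, coprimep g f,
        exists2 b : polyquot f, unit_square b & to_quot f g = alpha * b
      & unit_square (to_quot g f)].

Definition square_reflexive : Prop :=
  forall f, f != 0 -> square_free f -> square_reflexive_poly f.

End SquareReflexive.

Section PolynomialIdeals.
Variables (R : comNzRingType) (n m : nat) (F : 'I_m -> {mpoly R[n]}).

Definition in_ideal (p : {mpoly R[n]}) : Prop :=
  exists c : 'I_m -> {mpoly R[n]}, p = \sum_(i < m) c i * F i.

Definition ideal_prime : Prop :=
  ~ in_ideal 1 /\
  forall p q, in_ideal (p * q) -> in_ideal p \/ in_ideal q.

Definition alg_independent k (t : k.-tuple {mpoly R[n]}) : Prop :=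
  forall p : {mpoly R[k]}, in_ideal (p \mPo t) -> p = 0.

(* For a prime ideal over a field: the transcendence degree of the function
   field of the zero locus, i.e. of the fraction field of the coordinate ring.
   It is the maximal size of an algebraically independent family in the
   coordinate ring itself. *)
Definition locus_dim (d : nat) : Prop :=
  (exists t : d.-tuple {mpoly R[n]}, alg_independent t) /\
  ~ (exists t : d.+1.-tuple {mpoly R[n]}, alg_independent t).

End PolynomialIdeals.

Section PAC.
Variable E : fieldType.

Definition is_algebraic_closure (L : closedFieldType)
    (iota : {rmorphism E -> L}) : Prop :=
  forall z : L, algebraicOver iota z.

(* The closed subscheme F = 0 of affine n-space is integral after base change
   to an algebraic closure.  All algebraic closures of E are isomorphic; the
   quantifier spares the choice of one. *)
Definition absolutely_irreducible n m (F : 'I_m -> {mpoly E[n]}) : Prop :=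
  forall (L : closedFieldType) (iota : {rmorphism E -> L}),
    is_algebraic_closure iota ->
    ideal_prime (fun i => map_mpoly iota (F i)).

(* Every curve contains a dense open affine curve, so it suffices to quantify
   over closed curves in affine spaces. *)
Definition pseudo_algebraically_closed : Prop :=
  forall n m (F : 'I_m -> {mpoly E[n]}),
    absolutely_irreducible F -> locus_dim F 1 ->
    exists x : 'I_n -> E, forall i, (F i).@[x] = 0.

Definition finite_field : Prop := exists s : seq E, forall x, x \in s.

End PAC.

(* Main.v *)
From HB Require Import structures.
Require Import Defs.
From mathcomp Require Import all_boot all_algebra all_field.
From mathcomp Require Import ring_quotient ring zify cyclic.
From Stdlib Require Import Classical_Prop ClassicalEpsilon.

(** Write N for the norm of E_f = E[X]/(f).  Over a field K splitting f, with
    roots r counted with multiplicity, N(p) is the product of the p(r)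
    ([quot_norm_poly]); in particular N(a - X) = f(a) / lc(f).  When f is constant,
    E_f is the zero ring and g = 1 works.

    Pseudo-algebraically closed fields.  Given a unit alpha of E_f, consider
    the equation B^2 = alpha^-1 * (a - X) in E_f, whose unknowns are a and the
    coefficients of B, together with z * f(a) = 1, which keeps a away from the
    roots of f.  Its solutions form an absolutely irreducible curve
    ([curve_function_ring]): over K the equation says that B(r) is a square root
    of alpha(r)^-1 * (a - r) for every root r, the products of these radicands over
    nonempty sets of distinct roots are not squares in K(a), so that, by Kummer
    theory ([sqrt_tower]), the subset products of the square roots y_r are
    linearly independent over K(a), and every function on the curve is a
    combination of these products with coefficients in K[a, 1/f(a)].  A repeated
    root r, which an inseparable square-free f can have, adds no function: the
    equation determines B modulo a power of X - r from B(r) ([sqrt_coefs_in]).  A rational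
    point gives a in E with a - X in alpha * E_f^2, so f(a) is lc(f) * N(alpha) up
    to a nonzero square.  If N(alpha) is lc(f) times a square, then f(a), which is
    f modulo a - X, is a square and g = a - X works.  If N(alpha) is a square,
    the curve b^2 = f(a) first gives a_1 with f(a_1) a nonzero square; it is
    absolutely irreducible because a square-free nonconstant f is not a square over any
    extension ([square_free_not_square]).  The argument above for
    alpha * (a_1 - X) gives a_2 such that f(a_2) is also a square, and
    g = (a_1 - X) * (a_2 - X) works, or g = 1 if a_1 = a_2.

    Finite fields with q elements.  Let chi be the quadratic character,
    (f/d) = chi(N_d(f)) and (h/f) = chi(N_f(h)), both 0 when the arguments are not
    coprime, and for m monic coprime to f let r(m) be the sum of (f/d) over the
    monic divisors d of m.  As (f/d) is multiplicative in d, r(m) is nonnegative,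
    and if it is nonzero, then m = g * s^2 where f is a square modulo g
    ([all_divisor_sum_structure]).  So it suffices to find m congruent to alpha
    modulo f with r(m) nonzero.  Summing r over all monic m of degree k >= 2 deg f
    congruent to b modulo f gives (1 + e^k * (b/f)) * W_k, where the sign e comes
    from the reciprocity law (f/d) = e^(deg d) * (d/f) and W_k depends only on k
    ([sum_all_divisor_sum]).  For b = 1 and k even, nonnegativity of r and a square m
    make the sum positive, hence W_k > 0 for all k >= 2 deg f.  If N(alpha) is a
    square, take b = alpha and k even; if it is lc(f) times a square, take
    b = -alpha and k odd, and replace g by -g. *)

Set Implicit Arguments.
Unset Strict Implicit.
Unset Printing Implicit Defensive.
Import GRing.Theory.
Local Open Scope ring_scope.

Definition horner_ringE := (hornerD, hornerN, hornerM, hornerX, hornerC, horner_exp).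

(** * Splitting fields and norms in E[X]/(f) *)

Lemma irreducible_factor (F : fieldType) (p : {poly F}) :
  (1 < size p)%N -> exists2 r, irreducible_poly r & r %| p.
Proof.
have [n] := ubnP (size p); elim: n => // n IHn in p * => ltpn p_gt1.
have [irr|nirr] := classic (irreducible_poly p); first by exists p.
have [q [q1 qp nqp]] : exists q : {poly F}, [/\ size q != 1, q %| p & ~~ (q %= p)].
  apply: NNPP => nq; apply: nirr; split=> // q q1 qp.
  by apply/negPn/negP => nqp; apply: nq; exists q.
have p0 : p != 0 by rewrite -size_poly_gt0 ltnW.
have q0 : q != 0 by apply: dvdpN0 qp p0.
have q_gt1 : (1 < size q)%N by rewrite ltn_neqAle eq_sym q1 size_poly_gt0.
have ltq : (size q < size p)%N.
  by rewrite ltn_neqAle dvdp_leq // andbT dvdp_size_eqp.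
have [r irr rq] := IHn q (leq_trans ltq ltpn) q_gt1.
by exists r => //; apply: dvdp_trans rq qp.
Qed.

(** Roots are counted with multiplicity and nothing is said about the degree of K:
    inseparable polynomials are allowed, and only the values at the roots matter. *)
Lemma split_exists (F : fieldType) (p : {poly F}) : p != 0 ->
  exists (K : fieldType) (iota : {rmorphism F -> K}) (rs : seq K),
    map_poly iota p = iota (lead_coef p) *: \prod_(r <- rs) ('X - r%:P).
Proof.
have [n] := ubnP (size p); elim: n => // n IHn in F p * => ltpn p0.
have [p_le1|p_gt1] := leqP (size p) 1.
  exists F, idfun, [::]; rewrite big_nil map_poly_id // alg_polyC /=.
  by rewrite {1}[p]size1_polyC // /lead_coef -subn1 (eqP (_ : _ - 1 == 0)%N).
have [r irr rp] := irreducible_factor p_gt1.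
have [L [k [z rz]]] : exists (L : fieldType) (k : {rmorphism F -> L}) (z : L),
    root (map_poly k r) z.
  have [L _ [z rz _]] := irredp_FAdjoin irr.
  by exists L, (in_alg L), z.
have /factor_theorem[q Dp] : root (map_poly k p) z.
  by rewrite -(divpK rp) rmorphM rootM rz orbT.
have Dszp : size p = (size q).+1.
  rewrite -(size_map_poly k) Dp size_mul ?polyXsubC_eq0 //.
    by rewrite size_XsubC addn2.
  by apply: contraNneq p0 => q0; rewrite -(map_poly_eq0 k) Dp q0 mul0r.
have q0 : q != 0 by rewrite -size_poly_gt0 -ltnS -Dszp.
rewrite Dszp ltnS in ltpn.
have [K [j [rs Dq]]] := IHn _ q ltpn q0.
exists K, (j \o k), (rcons rs (j z)).
have -> : map_poly (j \o k) p = map_poly j (q * ('X - z%:P)).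
  by rewrite -Dp -map_poly_comp.
rewrite rmorphM /= Dq map_polyXsubC big_rcons /= scalerAl; congr (_ *: _ * _).
have := lead_coef_map k p; rewrite Dp lead_coefM lead_coefXsubC mulr1 => -> //.
Qed.

(** After an extension q is a product of linear factors X - s, and det (A - s) is,
    up to sign, the value at s of the characteristic polynomial. *)
Lemma det_horner_mx (K : fieldType) m (A : 'M[K]_m.+1) (rs : seq K) q :
  char_poly A = \prod_(r <- rs) ('X - r%:P) ->
  \det (horner_mx A q) = \prod_(r <- rs) q.[r].
Proof.
move=> chA.
have srs : size rs = m.+1.
  apply/eqP; rewrite -eqSS -(size_prod_XsubC rs id) /= -chA.
  by rewrite size_char_poly.
have [->|q0] := eqVneq q 0.
  case: rs {chA} srs => // r rs _.
  by rewrite rmorph0 det0 big_cons horner0 mul0r.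
have [K' [j [ss Dq]]] := split_exists q0.
apply: (fmorph_inj j).
rewrite -det_map_mx map_horner_mx Dq.
set A' := map_mx j A.
have chA' : char_poly A' = \prod_(r <- rs) ('X - (j r)%:P).
  rewrite -map_char_poly chA rmorph_prod.
  by apply: eq_bigr => r _; rewrite /= map_polyXsubC.
have detX s : \det (horner_mx A' ('X - s%:P)) = \prod_(r <- rs) (j r - s).
  rewrite rmorphB /= horner_mx_X horner_mx_C.
  have -> : A' - s%:M = - 1 *: map_mx (horner_eval s) (char_poly_mx A').
    apply/matrixP=> i k; rewrite !mxE /horner_eval !hornerE.
    by rewrite hornerMn hornerX mulN1r opprB.
  rewrite detZ det_map_mx -/(char_poly A') chA' /= /horner_eval horner_prod -srs.
  elim: (rs) => [|r rs' IH]; rewrite ?big_nil ?expr0 ?mulr1 //=.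
  by rewrite !big_cons exprS mulrACA IH hornerXsubC mulN1r opprB.
rewrite -mul_polyC rmorphM /= horner_mx_C det_mulmx det_scalar.
have -> : \det (horner_mx A' (\prod_(r <- ss) ('X - r%:P))) =
    \prod_(s <- ss) \prod_(r <- rs) (j r - s).
  elim: ss {Dq} => [|s ss IH]; first by rewrite !big_nil rmorph1 det1.
  by rewrite !big_cons rmorphM /= det_mulmx IH detX.
rewrite exchange_big /= rmorph_prod /= -srs -count_predT -iter_mulr_1 -big_const_seq
  -big_split /=.
apply: eq_bigr => r _ /=.
rewrite -horner_map Dq hornerZ; congr (_ * _).
by rewrite horner_prod; apply: eq_bigr => s _; rewrite hornerXsubC.
Qed.

(** The regular representation of E[X]/(f) in any basis is such a family [mu]. The
    minimal polynomial of mu(X) is associated to f, whose degree is the size of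
    the matrices, so that the characteristic polynomial is f divided by its
    leading coefficient. *)
Lemma det_poly_rep (E K : fieldType) (iota : {rmorphism E -> K}) (f : {poly E})
    (rs : seq K) m (mu : {poly E} -> 'M[E]_m) :
  f != 0 -> (size f).-1 = m ->
  (forall c p q, mu (c *: p + q) = c *: mu p + mu q) ->
  (forall p q, mu (p * q) = mu p *m mu q) -> mu 1 = 1%:M ->
  (forall p, mu p = 0 <-> f %| p) ->
  map_poly iota f = iota (lead_coef f) *: \prod_(r <- rs) ('X - r%:P) ->
  forall p, iota (\det (mu p)) = \prod_(r <- rs) (map_poly iota p).[r].
Proof.
move=> f0; case: m mu => [|m] mu szf muL muM mu1 mu0 Df p.
  have : size rs = 0%N.
    have := congr1 (fun p : {poly K} => (size p).-1) Df.
    rewrite size_scale ?fmorph_eq0 ?lead_coef_eq0 //.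
    by rewrite size_map_poly size_prod_XsubC szf.
  by case: (rs) => // _; rewrite big_nil det_mx00 rmorph1.
have f_gt1 : (1 < size f)%N by case: (size f) szf => [|[]].
have muC c : mu c%:P = c%:M.
  have := muL c 1 0; rewrite addr0 alg_polyC mu1 scalemx1 => ->.
  by have := muL 1 0 0; rewrite !scale1r addr0 -[LHS]addr0 => /addrI <-; rewrite addr0.
have muE q : mu q = horner_mx (mu 'X) q.
  elim/poly_ind: q => [|q c IH]; first by rewrite -[0]/(0%:P) muC horner_mx_C.
  have -> : mu (q * 'X + c%:P) = mu (q * 'X) + mu c%:P.
    by have := muL 1 (q * 'X) c%:P; rewrite !scale1r.
  by rewrite muM muC rmorphD rmorphM /= horner_mx_X horner_mx_C IH.
have eqf : mxminpoly (mu 'X) %= f.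
  apply/andP; split; first by apply/mxminpoly_minP; rewrite -muE; apply/mu0.
  by apply/mu0; rewrite muE mx_root_minpoly.
have chE : char_poly (mu 'X) = (lead_coef f)^-1 *: f.
  have lf : lead_coef f != 0 by rewrite lead_coef_eq0.
  have : f %= char_poly (mu 'X).
    rewrite -dvdp_size_eqp; first by rewrite size_char_poly -szf prednK // ltnW.
    by rewrite -(eqp_dvdl _ eqf) mxminpoly_dvd_char.
  move=> /eqp_eq; rewrite (monicP (char_poly_monic _)) scale1r => {2}->.
by rewrite scalerA mulVf // scale1r.
rewrite muE -det_map_mx map_horner_mx; apply: det_horner_mx.
rewrite -map_char_poly chE map_polyZ Df scalerA fmorphV mulVf ?scale1r //.
by rewrite fmorph_eq0 lead_coef_eq0.
Qed.

Section Norm.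
Variables (E : fieldType) (f : {poly E}).
Implicit Types (p q : {poly E}).

Definition normp p := quot_norm (to_quot f p).

Lemma linfun_quot_mulE (x y : polyquot f) : linfun (quot_mul x) y = x * y.
Proof. by rewrite lfunE. Qed.

Lemma quot_normM (x y : polyquot f) :
  quot_norm (x * y) = quot_norm x * quot_norm y.
Proof.
rewrite /quot_norm -det_mulmx -passmx.mxof_comp ?vbasisP //.
congr (\det (passmx.mxof _ _ _)); apply/lfunP=> z.
by rewrite comp_lfunE !linfun_quot_mulE mulrCA mulrA.
Qed.

Lemma quot_norm_poly (K : fieldType) (iota : {rmorphism E -> K}) (rs : seq K) p :
  f != 0 ->
  map_poly iota f = iota (lead_coef f) *: \prod_(r <- rs) ('X - r%:P) ->
  iota (normp p) = \prod_(r <- rs) (map_poly iota p).[r].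
Proof.
move=> f0 Df; pose B := vbasis {:polyquot f}.
have Bb : basis_of {:polyquot f} B by apply: vbasisP.
pose mu p := passmx.mxof B B (linfun (quot_mul (to_quot f p))).
apply: (@det_poly_rep _ _ _ f rs _ mu) => // [||q r||q].
- by rewrite dim_polyn.
- move=> c q r; rewrite /mu -passmx.mxof_linear; congr (passmx.mxof _ _ _).
  apply/lfunP=> z; rewrite add_lfunE scale_lfunE !linfun_quot_mulE linearP.
  by rewrite ![_ * z]mulrC; apply: quot_mul_linear.
- rewrite /mu -passmx.mxof_comp //; congr (passmx.mxof _ _ _); apply/lfunP=> z.
  by rewrite comp_lfunE !linfun_quot_mulE rmorphM mulrCA mulrA.
- rewrite /mu -(passmx.mxof1 (basis_free Bb)); congr (passmx.mxof _ _ _).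
  by apply/lfunP=> z; rewrite linfun_quot_mulE rmorph1 mul1r id_lfunE.
rewrite -to_quot_eq0 //; split=> [/eqP|/eqP e].
  rewrite passmx.mxof_eq0 // => /eqP/lfunP/(_ 1).
  by rewrite linfun_quot_mulE mulr1 lfunE => ->.
apply/eqP; rewrite passmx.mxof_eq0 //; apply/eqP/lfunP=> z.
by rewrite linfun_quot_mulE e mul0r lfunE.
Qed.

Lemma normpM p q : normp (p * q) = normp p * normp q.
Proof. by rewrite /normp rmorphM quot_normM. Qed.

Lemma normp_subX a : f != 0 ->
  normp (a%:P - 'X) = (lead_coef f)^-1 * f.[a].
Proof.
move=> f0.
have [K [iota [rs Df]]] := split_exists f0; apply: (fmorph_inj iota).
rewrite (quot_norm_poly _ f0 Df) rmorphM fmorphV -horner_map /= Df hornerZ.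
rewrite mulKf ?fmorph_eq0 ?lead_coef_eq0 // horner_prod; apply: eq_bigr => r _.
by rewrite rmorphB /= map_polyC map_polyX !hornerE.
Qed.

Lemma is_unit_to_quot p : f != 0 -> is_unit (to_quot f p) <-> coprimep f p.
Proof.
move=> f0; split=> [[y]|/Bezout_eq1_coprimepP[u /= e]]; last first.
  exists (to_quot f u.2); have := congr1 (to_quot f) e.
  rewrite rmorph1 => <-; rewrite rmorphD /= [X in _ = X + _](_ : _ = 0).
    by rewrite add0r mulrC rmorphM.
  by apply/eqP; rewrite to_quot_eq0 // dvdp_mull.
have [q <-] := to_quot_surj y; rewrite -rmorphM -(rmorph1 (to_quot f)).
move/eqP; rewrite -subr_eq0 -rmorphB to_quot_eq0 // => /dvdpP[k e].
by apply/Bezout_eq1_coprimepP; exists (- k, q); rewrite /= mulNr -e opprB mulrC subrK.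
Qed.

Lemma polyquot_trivial (x y : polyquot f) : (size f <= 1)%N -> x = y.
Proof.
move=> f_le1; apply: quot_rep_inj; have z0 (z : polyquot f) : quot_rep z = 0.
  apply/eqP; rewrite -size_poly_leq0 (leq_trans (size_npoly z)) //.
  by rewrite -subn1 leq_subLR addn0.
by rewrite !z0.
Qed.

End Norm.

Lemma is_unit_field (F : fieldType) (x : F) : is_unit x <-> x != 0.
Proof.
split=> [[y e]|x0]; last by exists x^-1; rewrite mulfV.
by apply: contraTneq isT => x0; move/eqP: e; rewrite x0 mul0r eq_sym oner_eq0.
Qed.

Lemma is_unit_poly (F : fieldType) (p : {poly F}) :
  is_unit p -> size p = 1%N.
Proof.
case=> q e; apply/eqP; rewrite -dvdp1; apply/dvdpP; exists q.
by rewrite mulrC.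
Qed.

Section ResidueClasses.
Variables (E : fieldType) (f : {poly E}).
Implicit Types (p q g : {poly E}).

Lemma to_quot_eq p q : f != 0 -> f %| p - q -> to_quot f p = to_quot f q.
Proof.
by move=> f0; rewrite -to_quot_eq0 // rmorphB subr_eq0 => /eqP.
Qed.

Lemma unit_square_to_quot p w : f != 0 -> coprimep f w -> f %| p - w ^+ 2 ->
  unit_square (to_quot f p).
Proof.
move=> f0 fw /to_quot_eq-> //; exists (to_quot f w); last by rewrite rmorphXn.
exact/is_unit_to_quot.
Qed.

Lemma normp1 : f != 0 -> normp f 1 = 1.
Proof.
move=> f0.
have [K [iota [rs Df]]] := split_exists f0; apply: (fmorph_inj iota).
rewrite (quot_norm_poly _ f0 Df) !rmorph1 big1 // => r _.
by rewrite hornerC.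
Qed.

Lemma normp_eq p q : f != 0 -> f %| p - q -> normp f p = normp f q.
Proof. by move=> f0 /(to_quot_eq f0) e; rewrite /normp e. Qed.

Lemma normp_neq0 p : f != 0 -> coprimep f p -> normp f p != 0.
Proof.
move=> f0.
move=> /(is_unit_to_quot _ f0)[y]; have [q <-] := to_quot_surj y.
rewrite -rmorphM => e; have : normp f (p * q) = normp f 1.
  by rewrite /normp e rmorph1.
rewrite normpM normp1 // => e1; apply/eqP => p0; move/eqP: e1.
by rewrite p0 mul0r eq_sym oner_eq0.
Qed.

Lemma coprimep_sub_dvd p q : f %| p - q -> coprimep f p -> coprimep f q.
Proof.
move=> fpq; have -> : q = p - (p - q) by rewrite subKr.
case/dvdpP: fpq => k ->; rewrite -mulNr addrC coprimep_addl_mul //.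
Qed.

End ResidueClasses.

(** The first condition on g, in terms of polynomials: the class of g is the class
    of p times the square of the unit B. *)
Lemma reflexive_witness (E : fieldType) (f p B g : {poly E}) : f != 0 -> coprimep f B ->
  coprimep f g ->
  f %| p * B ^+ 2 - g ->
  exists2 b : polyquot f, unit_square b & to_quot f g = to_quot f p * b.
Proof.
move=> f0 fB fg fpB; exists (to_quot f B ^+ 2).
  by exists (to_quot f B) => //; apply/is_unit_to_quot.
by rewrite -(to_quot_eq f0 fpB) rmorphM rmorphXn.
Qed.

Lemma square_reflexive_const (E : fieldType) (f : {poly E}) :
  (size f <= 1)%N -> square_reflexive_poly f.
Proof.
move=> f_le1 alpha _ _.
exists 1; split; rewrite ?oner_eq0 ?coprime1p //.
  exists 1; first by exists 1; [exists 1; rewrite mulr1 | rewrite expr1n].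
  exact: polyquot_trivial.
exists 1; last by apply: polyquot_trivial; rewrite size_poly1.
by exists 1; rewrite mulr1.
Qed.

(** * Multiquadratic extensions *)

(** The sum, over the bit sequences m of the length of ys, of g (c m) times the
    product of the entries of ys selected by m. The coefficients are kept apart
    from their images under g, so that the same c can be evaluated in several
    rings and its degrees can be bounded. *)
Fixpoint multilin (S : Type) (R : pzSemiRingType) (g : S -> R) (ys : seq R)
    (c : seq bool -> S) : R :=
  if ys is y :: ys' then
    multilin g ys' (fun m => c (false :: m)) + y * multilin g ys' (fun m => c (true :: m))
  else g (c [::]).

Lemma eq_multilin (S S' : Type) (R : pzSemiRingType) (g : S -> R) (g' : S' -> R) ys c c' :
  (forall m, g (c m) = g' (c' m)) -> multilin g ys c = multilin g' ys c'.
Proof.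
elim: ys c c' => [|y ys IH] c c' e /=; first exact: e.
by congr (_ + _ * _); apply: IH.
Qed.

Lemma multilinD (S : nmodType) (R : comPzRingType) (g : {additive S -> R}) ys c c' :
  multilin g ys (fun m => c m + c' m) = multilin g ys c + multilin g ys c'.
Proof.
elim: ys c c' => [|y ys IH] c c' /=; first by rewrite raddfD.
by rewrite !IH mulrDr addrACA.
Qed.

Lemma multilinZ (S : pzRingType) (R : comPzRingType) (g : {rmorphism S -> R}) ys c a :
  multilin g ys (fun m => a * c m) = g a * multilin g ys c.
Proof.
elim: ys c => [|y ys IH] c /=; first by rewrite rmorphM.
by rewrite !IH mulrDr [in RHS]mulrCA.
Qed.

Lemma rmorph_multilin (S : Type) (R R' : comPzRingType) (g : S -> R)
    (h : {rmorphism R -> R'}) ys c :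
  h (multilin g ys c) = multilin (fun x => h (g x)) (map h ys) c.
Proof.
by elim: ys c => [|y ys IH] c //=; rewrite rmorphD rmorphM !IH.
Qed.

Definition square_indep (R : comNzRingType) (us : seq R) :=
  forall m : bitseq, size m = size us -> has id m ->
    forall w, \prod_(u <- mask m us) u != w ^+ 2.

Lemma quadratic_extension (k : fieldType) (u : k) : (forall w, u != w ^+ 2) ->
  exists (K : fieldType) (j : {rmorphism k -> K}) (y : K),
  [/\ y ^+ 2 = j u, forall a b, j a + y * j b = 0 -> a = 0 /\ b = 0
    & forall x, exists a b, x = j a + y * j b].
Proof.
move=> nsq; have irr : irreducible_poly ('X^2 - u%:P).
  apply: cubic_irreducible.
    by rewrite size_XnsubC.
  move=> x; rewrite /root !hornerE subr_eq0 eq_sym; exact: nsq.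
have [K [j [z [rz gen]]]] : exists (K : fieldType) (j : {rmorphism k -> K}) (z : K),
    root (map_poly j ('X^2 - u%:P)) z /\
    forall x, exists p, x = (map_poly j p).[z].
  have [L dimL [z rz fullz]] := irredp_FAdjoin irr.
  exists L, (in_alg L), z; split=> // x.
  have /Fadjoin1_polyP[p ->] : x \in <<1; z>>%VS by rewrite fullz memvf.
  by exists p.
move: rz; rewrite rmorphB /= map_polyXn map_polyC rootE !hornerE subr_eq0 => /eqP z2.
exists K, j, z; split=> // [a b e|x].
  have [b0|b0] := eqVneq b 0.
    move: e; rewrite b0 rmorph0 mulr0 addr0 => /eqP.
    by rewrite fmorph_eq0 => /eqP.
  have : j u = j ((- a / b) ^+ 2).
    rewrite -z2 rmorphXn rmorphM rmorphN fmorphV /=; congr (_ ^+ 2).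
    apply: (canRL (mulfK _)); first by rewrite fmorph_eq0.
    by apply/eqP; rewrite -addr_eq0 addrC; apply/eqP.
  by move/fmorph_inj/eqP; rewrite (negbTE (nsq _)).
have [p ->] := gen x; pose r := p %% ('X^2 - u%:P).
have szr : (size r <= 2)%N.
  by rewrite -ltnS (leq_trans (ltn_modpN0 _ _)) ?size_XnsubC // -size_poly_gt0 size_XnsubC.
exists r`_0, r`_1; rewrite [in LHS](divp_eq p ('X^2 - u%:P)) -/r.
rewrite rmorphD rmorphM rmorphB /= map_polyXn map_polyC !hornerE z2 subrr mulr0 add0r.
rewrite (@horner_coef_wide _ 2) ?size_map_poly // 2!big_ord_recl big_ord0.
by rewrite !coef_map /= expr0 mulr1 addr0 expr1 mulrC.
Qed.

(** Kummer theory for square roots: the products of a subset of the square roots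
    are linearly independent. Adjoining the square roots one at a time, what has
    to be preserved is [square_indep]: if P in k is a square in k(sqrt u), then P
    or P * u is a square in k, because the cross term 2ab of (a + b sqrt u)^2
    vanishes. *)
Lemma sqrt_tower (k : fieldType) (us : seq k) : 2%:R != 0 :> k ->
  square_indep us ->
  exists (Omega : fieldType) (j : {rmorphism k -> Omega}) (ys : seq Omega),
  map (fun y => y ^+ 2) ys = map j us /\
  forall c, multilin j ys c = 0 -> forall m, size m = size us -> c m = 0.
Proof.
move: {2}(size us) (erefl (size us)) => n szn.
elim: n k us szn => [|n IH] k [|u us] // szn k2 ind.
  by exists k, idfun, [::]; split=> // c c0 [].
have nsq : forall w, u != w ^+ 2.
  move=> w; have := ind (true :: nseq (size us) false).
  rewrite /= size_nseq mask_false big_seq1 => /(_ erefl isT); exact.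
have [K [j [z [z2 jz gen]]]] := quadratic_extension nsq.
have [||m|Om [i [ys [ysE ysI]]]] := IH K (map j us) _.
- by rewrite size_map; case: szn.
- by rewrite -(rmorph_nat j) fmorph_eq0.
- rewrite size_map => szm hasm w; apply/negP => /eqP.
  rewrite -map_mask big_map -rmorph_prod; set P := \prod_(_ <- _) _ => jP.
  have [a [b we]] := gen w.
  have [|ab0 Pe] := jz (P - a ^+ 2 - u * b ^+ 2) (- (2%:R * (a * b))).
    rewrite !rmorphB rmorphN !expr2 !rmorphM /= rmorph_nat jP we -z2.
    by ring.
  have : a * b == 0 by move/eqP: Pe; rewrite oppr_eq0 mulf_eq0 (negbTE k2).
  rewrite mulf_eq0 => /orP[] /eqP e.
    have /(_ _ (u * b)) /eqP[] := ind (true :: m) _ isT; first by rewrite /= szm.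
    rewrite big_cons -/P.
    move/eqP: ab0; rewrite e expr0n /= subr0 subr_eq0 => /eqP ->.
    by ring.
  have /(_ _ a) /eqP[] := ind (false :: m) _ hasm; first by rewrite /= szm.
  rewrite -/P; apply/eqP.
  by move/eqP: ab0; rewrite e expr0n /= mulr0 subr0 subr_eq0.
exists Om, (i \o j), (i z :: ys); split=> [|c c0 [//|b m] [szm]].
  by rewrite /= ysE -rmorphXn z2 -map_comp.
have := ysI (fun m => j (c (false :: m)) + z * j (c (true :: m))).
rewrite multilinD multilinZ.
have -> : multilin i ys (fun m => j (c (false :: m)))
  = multilin (i \o j) ys (fun m => c (false :: m)).
  exact: eq_multilin.
have -> : multilin i ys (fun m => j (c (true :: m)))
  = multilin (i \o j) ys (fun m => c (true :: m)).
  exact: eq_multilin.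
rewrite size_map => /(_ c0 m szm) /jz[].
by case: b.
Qed.

Local Notation "x %:F" := (@FracField.tofrac _ x).

Lemma frac_rep (R : idomainType) (w : {fraction R}) :
  exists n d : R, d != 0 /\ w * d%:F = n%:F.
Proof.
elim/quotW: w => x; exists (frac x).1, (frac x).2; split.
  exact: denom_ratioP.
unlock FracField.tofrac; rewrite -[LHS]FracField.pi_mul; apply/eqmodP.
rewrite /= FracField.equivfE /FracField.mulf.
have x0 := denom_ratioP x.
by rewrite !numden_Ratio ?mulf_neq0 ?oner_neq0 // !mulr1 mulrC.
Qed.

(** A polynomial that is a square in K(a) is a square in K[a], as d^2 | n^2
    implies d | n. *)
Lemma square_indep_frac (K : fieldType) (us : seq {poly K}) :
  square_indep us -> square_indep (map (@FracField.tofrac {poly K}) us).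
Proof.
move=> ind m; rewrite size_map => szm hasm w; apply/negP => /eqP.
rewrite -map_mask big_map -rmorph_prod; set P := \prod_(_ <- _) _ => e.
have [n [d [d0 wE]]] := frac_rep w.
have Pd : P * d ^+ 2 = n ^+ 2.
  by apply/eqP; rewrite -tofrac_eq rmorphM !rmorphXn /= -wE e exprMn.
have : d ^+ 2 %| n ^+ 2 by rewrite -Pd dvdp_mull.
rewrite dvdp_pexp2r //= => /dvdpP [q nq].
have /eqP[] := ind m szm hasm q; rewrite -/P.
by apply: (mulIf (expf_neq0 2 d0)); rewrite Pd nq exprMn.
Qed.

Section ReducedForms.
Variables (K : fieldType) (A : comPzRingType) (g : {rmorphism {poly K} -> A}).

(** Products y_i^2 are replaced by the radicands, which raises the degrees by at
    most the sum of the sizes of the radicands; linear growth of the degrees is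
    what the dimension count in [has_form_alg_dep] needs. *)
Lemma multilin_mul us ys : map (fun y => y ^+ 2) ys = map g us ->
  forall (c c' : seq bool -> {poly K}) N M, (forall m, size (c m) <= N)%N ->
    (forall m, size (c' m) <= M)%N ->
  exists2 c'' : seq bool -> {poly K}, multilin g ys c * multilin g ys c' = multilin g ys c'' &
    forall m, (size (c'' m) <= N + M + \sum_(u <- us) size u)%N.
Proof.
elim: ys us => [|y ys IH] [|u us] //= e c c' N M cN c'M.
  exists (fun m => c m * c' m); first by rewrite rmorphM.
  move=> m; rewrite big_nil addn0 (leq_trans (size_polyMleq _ _)) //.
  by rewrite (leq_trans (leq_pred _)) // leq_add.
case: e => yu e.
have [||c00 e00 s00] := IH us e (fun m => c (false :: m)) (fun m => c' (false :: m)) N M;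
  try by [].
have [||c01 e01 s01] := IH us e (fun m => c (false :: m)) (fun m => c' (true :: m)) N M;
  try by [].
have [||c10 e10 s10] := IH us e (fun m => c (true :: m)) (fun m => c' (false :: m)) N M;
  try by [].
have [||c11 e11 s11] := IH us e (fun m => c (true :: m)) (fun m => c' (true :: m)) N M; try by [].
exists (fun m => if m is b :: m then
    if b then c01 m + c10 m else c00 m + u * c11 m else 0).
  rewrite !multilinD multilinZ -e00 -e01 -e10 -e11 -yu; ring.
have leS m : (size (c00 m + u * c11 m)%R <= N + M + (size u + \sum_(u <- us) size u))%N.
  rewrite (leq_trans (size_polyD _ _)) // geq_max; apply/andP; split.
    by apply: leq_trans (s00 m) _; lia.
  apply: leq_trans (size_polyMleq _ _) _.
  by have := s11 m; lia.
have leT m : (size (c01 m + c10 m)%R <= N + M + (size u + \sum_(u <- us) size u))%N.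
  rewrite (leq_trans (size_polyD _ _)) // geq_max; apply/andP; split.
    by apply: leq_trans (s01 m) _; lia.
  by apply: leq_trans (s10 m) _; lia.
by case=> [|[] m]; rewrite big_cons // size_poly0.
Qed.

End ReducedForms.

(** * Square roots modulo a split polynomial *)

Section RootsInSubalgebra.
Variables (K : fieldType) (A : comNzRingType) (e : {rmorphism K -> A}).
Variable S : A -> Prop.
Hypothesis S_add : forall x y, S x -> S y -> S (x + y).
Hypothesis S_mul : forall x y, S x -> S y -> S (x * y).
Hypothesis S_const : forall c, S (e c).

Definition coefs_in (p : {poly A}) := forall i, S p`_i.

Lemma S_opp x : S x -> S (- x).
Proof. by move=> Sx; rewrite -mulN1r -(rmorphN1 e); apply: S_mul. Qed.

Lemma S_sub x y : S x -> S y -> S (x - y).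
Proof. by move=> Sx Sy; apply/S_add/S_opp. Qed.

Lemma S_zero : S 0. Proof. by rewrite -(rmorph0 e). Qed.

Lemma S_sum I (r : seq I) (F : I -> A) : (forall i, S (F i)) -> S (\sum_(i <- r) F i).
Proof. by move=> SF; apply: (big_ind S) => //; exact: S_zero. Qed.

Lemma coefs_in_sub p q : coefs_in p -> coefs_in q -> coefs_in (p - q).
Proof. by move=> Sp Sq i; rewrite coefB; apply: S_sub. Qed.

Lemma coefs_in_add p q : coefs_in p -> coefs_in q -> coefs_in (p + q).
Proof. by move=> Sp Sq i; rewrite coefD; apply: S_add. Qed.

Lemma coefs_in_mul p q : coefs_in p -> coefs_in q -> coefs_in (p * q).
Proof. by move=> Sp Sq i; rewrite coefM; apply: S_sum => j; apply: S_mul. Qed.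

Lemma coefs_in_map p : coefs_in (map_poly e p).
Proof. by move=> i; rewrite coef_map; apply: S_const. Qed.

Lemma coefs_in_const x : S x -> coefs_in x%:P.
Proof. by move=> Sx i; rewrite coefC; case: ifP => // _; apply: S_zero. Qed.

Lemma S_horner p c : coefs_in p -> S p.[e c].
Proof.
move=> Sp; rewrite horner_coef; apply: S_sum => i; apply: S_mul => //.
by rewrite -rmorphXn; apply: S_const.
Qed.

Lemma coefs_in_div_XsubC c p :
  coefs_in (('X - (e c)%:P) * p) -> coefs_in p.
Proof.
move=> Sp i; move: {2}(size p - i)%N (erefl (size p - i)%N) => k.
elim: k i => [|k IH] i szi.
  by rewrite nth_default -?subn_eq0 ?szi //; apply: S_zero.
have -> : p`_i = (('X - (e c)%:P) * p)`_i.+1 + e c * p`_i.+1.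
  by rewrite mulrBl coefB coefXM coefCM /= subrK.
apply/S_add/S_mul; [exact: Sp|exact: S_const|apply: IH].
by rewrite subnS szi.
Qed.

Definition lin_prod (rs : seq K) := \prod_(r <- rs) ('X - (e r)%:P).

Lemma lin_prodE rs : lin_prod rs = map_poly e (\prod_(r <- rs) ('X - r%:P)).
Proof.
by rewrite rmorph_prod; apply: eq_bigr => r _; rewrite /= map_polyXsubC.
Qed.

Lemma coefs_in_div rs p : coefs_in (lin_prod rs * p) -> coefs_in p.
Proof.
rewrite /lin_prod; elim: rs p => [|r rs IH] p; first by rewrite big_nil mul1r.
by rewrite big_cons -mulrA => /coefs_in_div_XsubC; apply: IH.
Qed.

Lemma size_lin_prod rs : size (lin_prod rs) = (size rs).+1.
Proof.
rewrite /lin_prod.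
by rewrite -(big_map e xpredT (fun x => 'X - x%:P)) size_prod_XsubC size_map.
Qed.

Lemma horner_lin_prod rs c : (lin_prod rs).[e c] = e (\prod_(r <- rs) (c - r)).
Proof.
rewrite /lin_prod horner_prod rmorph_prod; apply: eq_bigr => r _.
by rewrite !hornerE rmorphB.
Qed.

(** A square root of u modulo a split polynomial has its coefficients in any
    subalgebra S that contains those of u, the values of B at the roots and their
    inverses. B is reduced modulo X - r for one root r after the other, by Newton
    interpolation: the next coefficient q is found from B(r) if r is a new root.
    If r is a repeated root, B^2 = u modulo the next power of X - r is a linear
    equation for q whose leading coefficient 2 B(r) is invertible. This is why
    only the distinct roots count, even for inseparable polynomials. *)
Lemma sqrt_coefs_in (rs : seq K) (B u H : {poly A}) :
  2%:R != 0 :> K -> B ^+ 2 - u = lin_prod rs * H ->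
  coefs_in u -> (size B <= size rs)%N ->
  (forall r, r \in rs -> S B.[e r]) ->
  (forall r, r \in rs -> exists2 v, S v & B.[e r] * v = 1) ->
  coefs_in B.
Proof.
move=> K2 BuH Su szB SB invB.
have main ss ts : rs = ss ++ ts -> exists Q R, [/\ B = lin_prod ss * Q + R,
    coefs_in R & (size R <= size ss)%N].
  elim/last_ind: ss ts => [|ss r IH] ts rsE.
    exists B, 0; rewrite /lin_prod big_nil mul1r addr0 size_poly0; split=> //.
    by move=> i; rewrite coef0; apply: S_zero.
  have {IH}[|Q [R [BE SR szR]]] := IH (r :: ts); first by rewrite rsE cat_rcons.
  set G := lin_prod ss in BE.
  have rrs : r \in rs by rewrite rsE mem_cat mem_rcons inE eqxx.
  have SG : coefs_in G by rewrite /G lin_prodE; apply: coefs_in_map.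
  pose q := Q.[e r].
  have /factor_theorem[Q' QE] : root (Q - q%:P) (e r).
    by rewrite rootE !hornerE subrr.
  have GE : lin_prod (rcons ss r) = G * ('X - (e r)%:P).
    by rewrite /lin_prod big_rcons.
  have Sq : S q.
    have BrE : B.[e r] = G.[e r] * q + R.[e r] by rewrite BE !hornerE.
    have [rss|rss] := boolP (r \in ss).
      have Gr : G.[e r] = 0.
        rewrite horner_lin_prod; apply/eqP; rewrite -(rmorph0 e); apply/eqP.
        congr (e _); apply/eqP; rewrite prodf_seq_eq0; apply/hasP; exists r => //=.
        by rewrite subrr.
      rewrite Gr mul0r add0r in BrE.
      pose T := ('X - (e r)%:P) * lin_prod ts * H - G * (Q * Q) - Q * R - Q * R.
      have TE : R ^+ 2 - u = G * T.
        have := BuH; rewrite rsE /lin_prod big_cat big_rcons /= -/(lin_prod _).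
        rewrite -/(lin_prod _) -/G BE /T => /(canRL (subrK _)) eu.
        have -> : u = (G * Q + R) ^+ 2 - G * ('X - (e r)%:P) * lin_prod ts * H.
          by rewrite eu; ring.
        by ring.
      have ST : coefs_in T.
        apply: (@coefs_in_div ss); rewrite -/G -TE; apply: coefs_in_sub => //.
        by rewrite expr2; apply: coefs_in_mul.
      (* At r only the term -2QR of T remains, and R(r) = B(r), since r is a root of G. *)
      have Tr : T.[e r] = - 2%:R * (q * B.[e r]).
        rewrite /T !(hornerD, hornerN, hornerM, hornerX, hornerC) subrr Gr BrE -/q.
        by ring.
      have [v Sv vE] := invB r rrs.
      have -> : q = e (- (2%:R)^-1) * (T.[e r] * v).
        rewrite Tr -mulrA -[_ * _ * v]mulrA vE mulr1 mulrA.
        rewrite -(rmorph_nat e) -rmorphN -rmorphM mulrNN mulVf //.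
        by rewrite rmorph1 mul1r.
      by apply: S_mul => //; apply: S_mul => //; apply: S_horner.
    pose c := \prod_(s <- ss) (r - s).
    have c0 : c != 0.
      apply/negP; rewrite prodf_seq_eq0 => /hasP[s sss] /=.
      by rewrite subr_eq0 => /eqP rs'; rewrite rs' sss in rss.
    have -> : q = e c^-1 * (B.[e r] - R.[e r]).
      by rewrite BrE addrK horner_lin_prod mulrA -rmorphM mulVf // rmorph1 mul1r.
    apply: S_mul => //; apply: S_sub; [exact: SB|exact: S_horner].
  exists Q', (R + q%:P * G); split.
  - by rewrite GE BE -[Q](subrK q%:P) QE; ring.
  - apply: coefs_in_add => //; apply: coefs_in_mul => //.
    exact: coefs_in_const.
  rewrite size_rcons (leq_trans (size_polyD _ _)) // geq_max (leq_trans szR) //=.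
  by rewrite mul_polyC (leq_trans (size_scale_leq _ _)) // size_lin_prod.
have [|Q [R [BE SR szR]]] := main rs [::]; first by rewrite cats0.
have [Q0|Q0] := eqVneq Q 0; first by rewrite BE Q0 mulr0 add0r.
have Gmon : lin_prod rs \is monic by apply: monic_prod_XsubC.
have := size_polyD B (- R); rewrite BE addrK size_monicM // size_lin_prod.
rewrite -BE size_polyN leq_max => /orP[] h.
  by move: szB; rewrite leqNgt (leq_trans _ h) // addSn /= -addn1 leq_add2l size_poly_gt0.
by move: szR; rewrite leqNgt (leq_trans _ h) // addSn /= -addn1 leq_add2l size_poly_gt0.
Qed.

End RootsInSubalgebra.

(** Newton interpolation again, this time to construct B, with a Hensel step at
    each repeated root. *)
Lemma sqrt_mod_exists (K : fieldType) (rs : seq K) (u : {poly K}) (y : K -> K) :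
  2%:R != 0 :> K ->
  (forall r, r \in rs -> y r ^+ 2 = u.[r]) -> (forall r, r \in rs -> y r != 0) ->
  exists B H, B ^+ 2 - u = \prod_(r <- rs) ('X - r%:P) * H /\
     forall r, r \in rs -> B.[r] = y r.
Proof.
move=> K2; elim: rs => [|r rs IH] yu y0.
  by exists 0, (- u); rewrite big_nil expr0n mul1r sub0r.
have [s srs|s srs|B [H [BH By]]] := IH.
- by apply: yu; rewrite inE srs orbT.
- by apply: y0; rewrite inE srs orbT.
have yr := yu r (mem_head _ _); have yr0 := y0 r (mem_head _ _).
set G := \prod_(_ <- rs) _ in BH.
have step t : root (H + 2%:R * t%:P * B + t%:P ^+ 2 * G) r ->
    exists H', (B + t%:P * G) ^+ 2 - u = \prod_(s <- r :: rs) ('X - s%:P) * H'.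
  move/factor_theorem=> [H' HE]; exists H'; rewrite big_cons -/G.
  have -> : u = B ^+ 2 - G * H by rewrite -BH; ring.
  have -> : ('X - r%:P) * G * H' = G * (H' * ('X - r%:P)) by ring.
  by rewrite -HE; ring.
have G0 s : s \in rs -> G.[s] = 0.
  move=> srs; rewrite horner_prod; apply/eqP; rewrite prodf_seq_eq0.
  by apply/hasP; exists s => //=; rewrite !horner_ringE subrr.
have new t s : s \in rs -> (B + t%:P * G).[s] = y s.
  by move=> srs; rewrite !horner_ringE G0 // mulr0 addr0 By.
have [rrs|rrs] := boolP (r \in rs).
  pose t := - H.[r] / (2%:R * y r).
  have /step[H' HE] : root (H + 2%:R * t%:P * B + t%:P ^+ 2 * G) r.
    rewrite /root -polyC_natr !horner_ringE G0 // mulr0 addr0 By // /t.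
    by apply/eqP; field; rewrite yr0 K2.
  exists (B + t%:P * G), H'; split=> // s; rewrite inE => /orP[/eqP ->|srs]; exact: new.
have Gr : G.[r] != 0.
  rewrite horner_prod prodf_seq_neq0; apply/allP => s srs /=.
  by rewrite !horner_ringE subr_eq0; apply: contraNneq rrs => ->.
pose t := (y r - B.[r]) / G.[r].
have tr : (B + t%:P * G).[r] = y r.
  by rewrite !horner_ringE /t divfK // addrC subrK.
have /step[H' HE] : root (H + 2%:R * t%:P * B + t%:P ^+ 2 * G) r.
  have e : (B.[r] + t * G.[r]) ^+ 2 - u.[r] = G.[r] * (H.[r] + 2%:R * t * B.[r] + t ^+ 2 * G.[r]).
    have := congr1 (fun p => p.[r]) BH; rewrite !horner_ringE => e.
    have -> : u.[r] = B.[r] ^+ 2 - G.[r] * H.[r] by rewrite -e; ring.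
    by ring.
  have : (B + t%:P * G).[r] ^+ 2 - u.[r] = 0 by rewrite tr yr subrr.
  rewrite !horner_ringE e => /eqP; rewrite mulf_eq0 (negbTE Gr) /=.
  by rewrite /root -polyC_natr !horner_ringE.
exists (B + t%:P * G), H'; split=> // s; rewrite inE => /orP[/eqP ->//|]; exact: new.
Qed.

(** * Quotients of polynomial rings *)

Section QuotientRing.
Variables (R : comNzRingType) (I : R -> Prop).
Hypothesis I0 : I 0.
Hypothesis I1 : ~ I 1.
Hypothesis IMD : forall a x y, I x -> I y -> I (a * x + y).

Definition idealb (x : R) : bool := excluded_middle_informative (I x).

Lemma idealbP x : reflect (I x) (idealb x).
Proof. by rewrite /idealb; case: excluded_middle_informative => h; constructor. Qed.

Fact idealb_closed : idealr_closed idealb.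
Proof.
split; first by apply/idealbP.
  by apply/negP => /idealbP.
by move=> a x y /idealbP Ix /idealbP Iy; apply/idealbP/IMD.
Qed.

HB.instance Definition _ := isIdealr.Build R idealb idealb_closed.

(** An abstract quotient by an ideal given by a predicate: membership in the ideal
    is made boolean by excluded middle. *)
Lemma quotient_ring : exists (A : comNzRingType) (pi : {rmorphism R -> A}),
  (forall x, pi x = 0 <-> I x) /\ forall a, exists x, pi x = a.
Proof.
pose J : idealr R := idealb.
exists {ideal_quot J}, (\pi_{ideal_quot J})%qT; split.
  move=> x; split=> [/eqP|Ix].
    rewrite -(rmorph0 (\pi_{ideal_quot J})%qT) -Quotient.idealrBE subr0.
    by move/idealbP.
  apply/eqP; rewrite -(rmorph0 (\pi_{ideal_quot J})%qT) -Quotient.idealrBE subr0.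
  exact/idealbP.
move=> a; exists (repr a); exact: reprK.
Qed.

End QuotientRing.

Lemma mpoly_morph_ext (E : comNzRingType) (R : comNzRingType) n
    (s t : {rmorphism {mpoly E[n]} -> R}) :
  (forall c, s c%:MP = t c%:MP) -> (forall i, s 'X_i = t 'X_i) -> s =1 t.
Proof.
move=> sC sX p; rewrite (mpolyE p) !rmorph_sum; apply: eq_bigr => m _.
rewrite -mul_mpolyC !rmorphM sC mpolyXE_id !rmorph_prod; congr (_ * _).
by apply: eq_bigr => i _; rewrite !rmorphXn sX.
Qed.

(** * The curve of square roots in E[X]/(f) *)

Section Curve.
Variables (E : fieldType) (f D : {poly E}) (u : nat -> {poly E}).
Hypothesis f_mon : f \is monic.
Let n := (size f).-1.

(** The structure constants of E[X]/(f) in the basis of the powers of X. *)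
Definition structure_const m k : E := ('X^m %% f)`_k.

Definition poly_at (R : comNzRingType) (e : E -> R) (x : R) (p : {poly E}) : R :=
  (map_poly e p).[x].

Definition var_a : 'I_n.+2 := ord0.
Definition var_z : 'I_n.+2 := inord 1.
Definition var_b (j : 'I_n) : 'I_n.+2 := inord j.+2.

(** The curve B^2 = u_0(a) + u_1(a) X + ... + u_(n-1)(a) X^(n-1) in E[X]/(f),
    minus the zeros of D: the variables are a, the inverse z of D(a) and the
    coefficients b_j of B, and the equations are z D(a) = 1 and one for each power
    of X. *)
Definition curve_eq (k : 'I_n.+1) : {mpoly E[n.+2]} :=
  if unlift ord0 k is Some k' then
    \sum_(i < n) \sum_(j < n)
      (structure_const (i + j) k')%:MP * ('X_(var_b i) * 'X_(var_b j))
    - poly_at (@mpolyC n.+2 E) 'X_var_a (u k')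
  else 'X_var_z * poly_at (@mpolyC n.+2 E) 'X_var_a D - 1.

Lemma poly_at_morph (R R' : comNzRingType) (e : {rmorphism E -> R})
    (s : {rmorphism R -> R'}) x p : s (poly_at e x p) = poly_at (s \o e) (s x) p.
Proof. by rewrite /poly_at -horner_map -map_poly_comp. Qed.

Section Points.
Variables (R : comNzRingType) (s : {rmorphism {mpoly E[n.+2]} -> R}).
Let e : {rmorphism E -> R} := s \o @mpolyC n.+2 E.
Let a := s 'X_var_a.

Definition point_root : {poly R} :=
  \poly_(j < n) (if insub j is Some j' then s 'X_(var_b j') else 0).
Definition point_radicand : {poly R} := \poly_(k < n) poly_at e a (u k).

Lemma point_rootE : point_root = \sum_(j < n) s 'X_(var_b j) *: 'X^j.
Proof. by rewrite /point_root poly_def; apply: eq_bigr => j _; rewrite valK. Qed.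

Lemma curve_eq0 : s (curve_eq ord0) = s 'X_var_z * poly_at e a D - 1.
Proof.
by rewrite /curve_eq unlift_none rmorphB rmorphM rmorph1 /= poly_at_morph.
Qed.

Lemma curve_eqS (k : 'I_n) : s (curve_eq (lift ord0 k)) =
  \sum_(i < n) \sum_(j < n)
     e (structure_const (i + j) k) * (s 'X_(var_b i) * s 'X_(var_b j))
  - poly_at e a (u k).
Proof.
rewrite /curve_eq liftK rmorphB /= poly_at_morph; congr (_ - _).
rewrite rmorph_sum; apply: eq_bigr => i _; rewrite rmorph_sum; apply: eq_bigr => j _.
by rewrite !rmorphM.
Qed.

Lemma point_root_sqr : exists H, point_root ^+ 2 - point_radicand =
  map_poly e f * H + \poly_(k < n) (if insub k is Some k' then s (curve_eq (lift ord0 k'))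
    else 0).
Proof.
have f0 : f != 0 by apply: monic_neq0.
exists (\sum_(i < n) \sum_(j < n)
   (s 'X_(var_b i) * s 'X_(var_b j)) *: map_poly e ('X^(i + j) %/ f)).
rewrite expr2 point_rootE big_distrlr /= mulr_sumr.
rewrite [X in _ = _ + X](_ : _ = \sum_(i < n) \sum_(j < n)
   (s 'X_(var_b i) * s 'X_(var_b j)) *: map_poly e ('X^(i + j) %% f) - point_radicand);
     last first.
  apply/polyP => k; rewrite coefB coef_poly [point_radicand`_k]coef_poly;
    case: ltnP => [ltk|lek]; last first.
    rewrite subr0 coef_sum big1 // => i _; rewrite coef_sum big1 // => j _.
    rewrite coefZ coef_map /= nth_default ?rmorph0 ?mulr0 //.
    by rewrite (leq_trans _ lek) // -ltnS prednK ?size_poly_gt0 // ltn_modpN0.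
  rewrite insubT curve_eqS; congr (_ - _); rewrite coef_sum; apply: eq_bigr => i _.
  by rewrite coef_sum; apply: eq_bigr => j _; rewrite coefZ coef_map mulrC.
rewrite addrA; congr (_ - _); rewrite -big_split; apply: eq_bigr => i _ /=.
rewrite mulr_sumr -big_split; apply: eq_bigr => j _ /=.
rewrite -!scalerAr -scalerDr -scalerAl scalerA -exprD [X in X *: _]mulrC; congr (_ *: _).
by rewrite -(map_polyXn e) [X in map_poly _ X](divp_eq _ f) rmorphD rmorphM /= mulrC.
Qed.

(** Points with values in a ring, as homomorphisms s. For the quotient by the
    ideal this gives the relations in the coordinate ring, and for a function
    field it serves to construct a point. *)
Lemma curve_points : (forall k, s (curve_eq k) = 0) <->
  s 'X_var_z * poly_at e a D = 1 /\
  exists H, point_root ^+ 2 - point_radicand = map_poly e f * H.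
Proof.
have [H0 sqrE] := point_root_sqr.
split=> [c0|[zD [H BH]]].
  split; first by apply/eqP; rewrite -subr_eq0 -curve_eq0 c0.
  exists H0; rewrite sqrE [X in _ + X](_ : _ = 0) ?addr0 //.
  apply/polyP=> k; rewrite coef_poly coef0; case: ifP => // _.
  by case: insub => // k'.
move=> k; case: (unliftP ord0 k) => [k' ->|->]; last by rewrite curve_eq0 zD subrr.
set P := \poly_(_ < _) _ in sqrE.
have e0 : P = map_poly e f * (H - H0) by rewrite mulrBr -BH sqrE addrAC subrr add0r.
have : P`_k' = 0.
  have [H00|nz] := eqVneq (H - H0) 0; first by rewrite e0 H00 mulr0 coef0.
  have fm : map_poly e f \is monic by rewrite map_monic.
  have : (size P <= n)%N by apply: size_poly.
  rewrite e0 size_monicM // size_map_poly_id0; last by rewrite (monicP f_mon) rmorph1 oner_neq0.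
  have := size_poly_gt0 (H - H0); rewrite nz.
  have : (0 < size f)%N by rewrite size_poly_gt0 monic_neq0.
  by rewrite /n; lia.
by rewrite coef_poly ltn_ord valK.
Qed.

End Points.
End Curve.

(** * Multilinear forms over a localisation *)

Lemma multilin_const (S : nmodType) (R : comPzRingType) (g : {additive S -> R}) ys x :
  multilin g ys (fun m => if has id m then 0 else x) = g x.
Proof.
elim: ys => [|y ys IH] //=; rewrite IH.
have -> : multilin g ys (fun=> 0) = 0.
  by elim: ys {IH} => [|y' ys IH] /=; rewrite ?raddf0 // IH mulr0 addr0.
by rewrite mulr0 addr0.
Qed.

Lemma multilin_eq0 (S : nmodType) (R : comPzRingType) (g : {additive S -> R}) ys c :
  (forall m, size m = size ys -> c m = 0) -> multilin g ys c = 0.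
Proof.
elim: ys c => [|y ys IH] c c0 /=; first by rewrite c0 ?raddf0.
by rewrite !IH ?mulr0 ?addr0 // => m szm; rewrite c0 //= szm.
Qed.

Section Localised.
Variables (K : fieldType) (A : comNzRingType) (g : {rmorphism {poly K} -> A}).
Variables (us : seq {poly K}) (ys : seq A) (D : {poly K}) (z : A).
Hypothesis ys_sqr : map (fun y => y ^+ 2) ys = map g us.
Hypothesis zD : z * g D = 1.

Definition form_bound (M : nat) (x : A) :=
  exists2 c : seq bool -> {poly K}, (forall m, size (c m) <= M)%N & x = multilin g ys c.

Definition has_form (x : A) := exists N M x', form_bound M x' /\ x = z ^+ N * x'.

Lemma form_boundW M M' x : (M <= M')%N -> form_bound M x -> form_bound M' x.
Proof. by move=> le [c cM ->]; exists c => // m; apply: leq_trans (cM m) le. Qed.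

Lemma form_bound_const (p : {poly K}) : form_bound (size p) (g p).
Proof.
exists (fun m => if has id m then 0 else p); last by rewrite multilin_const.
by move=> m; case: ifP; rewrite ?size_poly0.
Qed.

Lemma form_boundM M M' x x' : form_bound M x -> form_bound M' x' ->
  form_bound (M + M' + \sum_(u <- us) size u) (x * x').
Proof.
move=> [c cM ->] [c' c'M ->].
by have [c'' -> ?] := multilin_mul ys_sqr cM c'M; exists c''.
Qed.

Lemma form_boundD M x x' : form_bound M x -> form_bound M x' -> form_bound M (x + x').
Proof.
move=> [c cM ->] [c' c'M ->]; exists (fun m => c m + c' m); last by rewrite multilinD.
by move=> m; rewrite (leq_trans (size_polyD _ _)) // geq_max cM c'M.
Qed.

Lemma expr_zD N : z ^+ N * g D ^+ N = 1.
Proof. by rewrite -exprMn zD expr1n. Qed.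

Lemma form_bound_has_form M x : form_bound M x -> has_form x.
Proof. by move=> h; exists 0%N, M, x; rewrite mul1r. Qed.

Lemma has_form_const (p : {poly K}) : has_form (g p).
Proof. exact: form_bound_has_form (form_bound_const p). Qed.

Lemma has_form_z : has_form z.
Proof.
exists 1%N, (size (1 : {poly K})), 1; rewrite mulr1; split=> //.
by rewrite -(rmorph1 g); apply: form_bound_const.
Qed.

Lemma has_formM x y : has_form x -> has_form y -> has_form (x * y).
Proof.
move=> [N [M [x' [xM ->]]]] [N' [M' [y' [yM ->]]]].
exists (N + N')%N, (M + M' + \sum_(u <- us) size u)%N, (x' * y'); split.
  exact: form_boundM.
by rewrite mulrACA exprD.
Qed.

Lemma has_formD x y : has_form x -> has_form y -> has_form (x + y).
Proof.
move=> [N [M [x' [xM ->]]]] [N' [M' [y' [yM ->]]]].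
have xM' := form_boundM (form_bound_const (D ^+ N')) xM.
have yM' := form_boundM (form_bound_const (D ^+ N)) yM.
have := form_boundD (form_boundW (leq_maxl _ _) xM') (form_boundW (leq_maxr _ _) yM').
move=> sM; exists (N + N')%N; eexists; eexists; split; first exact: sM.
rewrite !rmorphXn mulrDr exprD !mulrA; congr (_ * _ + _ * _).
  by rewrite -mulrA expr_zD mulr1.
by rewrite [z ^+ N * _]mulrC -mulrA expr_zD mulr1.
Qed.

Lemma form_bound_var y : y \in ys -> form_bound 1 y.
Proof.
rewrite /form_bound; elim: ys => // y' ys' IH; rewrite inE => /orP[/eqP ->|/IH[c cM yE]].
  exists (fun m => if m is true :: m then if has id m then 0 else 1 else 0) => /=.
    by case=> [|[] m] //; rewrite ?size_poly0 //; case: ifP; rewrite ?size_poly0 ?size_poly1.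
  rewrite [X in X + _]multilin_eq0 // add0r multilin_const -[LHS]mulr1; congr (_ * _).
  by apply: esym; apply: rmorph1.
exists (fun m => if m is false :: m then c m else 0) => /=.
  by case=> [|[] m]; rewrite ?size_poly0.
by rewrite [X in _ * X]multilin_eq0 // mulr0 addr0.
Qed.

Lemma form_bound_prod M xs : (forall x, x \in xs -> form_bound M x) ->
  form_bound (size xs * (M + \sum_(u <- us) size u)).+1 (\prod_(x <- xs) x).
Proof.
elim: xs => [|x xs IH] h.
  by rewrite big_nil; have := form_bound_const 1; rewrite size_poly1 rmorph1.
rewrite big_cons; apply: form_boundW (form_boundM (h x (mem_head _ _)) (IH _)).
  by rewrite /= mulSn addnS addSn addnAC.
by move=> y yxs; apply: h; rewrite inE yxs orbT.
Qed.

Lemma multilin_sum (P : finType) (c : P -> seq bool -> {poly K}) :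
  multilin g ys (fun m => \sum_p c p m) = \sum_p multilin g ys (c p).
Proof.
elim: (index_enum P) => [|p s IH].
  by rewrite big_nil multilin_eq0 // => m _; rewrite big_nil.
rewrite big_cons -IH -multilinD; apply: eq_multilin => m; by rewrite big_cons.
Qed.

(** Linear algebra: the forms with coefficients of size at most X are parametrised
    by a space of dimension 2^|ys| * X. *)
Lemma form_bound_dep (P : finType) X (F : P -> A) :
  (forall p, form_bound X (F p)) -> (2 ^ size ys * X < #|P|)%N ->
  exists2 v : P -> K, (exists p, v p != 0) & \sum_p g (v p)%:P * F p = 0.
Proof.
move=> FX cardP.
have /fin_all_exists[c cP] : forall p, exists c : seq bool -> {poly K},
    (forall m, size (c m) <= X)%N /\ F p = multilin g ys c.
  by move=> p; have [c ? ?] := FX p; exists c.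
pose T : finType := ((size ys).-tuple bool * 'I_X)%type.
pose V : 'M[K]_(#|P|, #|T|) := \matrix_(i < #|P|, j < #|T|)
   let q : T := enum_val j in (c (enum_val i) q.1)`_q.2.
have : kermx V != 0.
  rewrite kermx_eq0 /row_free; apply: contraTneq cardP => rV.
  rewrite -leqNgt -{1}rV (leq_trans (rank_leq_col _)) //.
  by rewrite card_prod card_tuple card_bool card_ord.
case/rowV0Pn=> v /sub_kermxP vV v0.
exists (fun p => v 0 (enum_rank p)).
  have [j vj] : exists j, v 0 j != 0.
    apply: NNPP => nj; move/eqP: v0; apply; apply/rowP => j; rewrite mxE.
    by apply/eqP/negPn/negP => vj; apply: nj; exists j.
  by exists (enum_val j); rewrite enum_valK.
under eq_bigr => p _ do rewrite (cP p).2 -multilinZ.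
rewrite -multilin_sum multilin_eq0 // => m szm; apply/polyP=> k; rewrite coef0 coef_sum.
have [ltk|lek] := ltnP k X; last first.
  apply: big1 => p _; rewrite coefCM nth_default ?mulr0 //.
  by apply: leq_trans lek; apply: (cP p).1.
have := congr1 (fun w : 'rV_ _ => w 0 (enum_rank ((tcast szm (in_tuple m), Ordinal ltk) : T))) vV.
rewrite !mxE (reindex (@enum_rank P)) /=; last first.
  by apply: onW_bij; apply: enum_rank_bij.
move=> vVm; rewrite -[RHS]vVm; apply: eq_bigr => p _; rewrite coefCM !mxE !enum_rankK /=.
by rewrite val_tcast.
Qed.

(** Two elements are algebraically dependent over K. Multiplied by w^(2L), which
    clears denominators, each of the L^2 monomials x1^i x2^j with i, j < L is a
    product of 2L forms of bounded degree, so the degrees grow linearly with L,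
    and so does the dimension of the space that contains these monomials. *)
Lemma has_form_alg_dep x1 x2 : has_form x1 -> has_form x2 ->
  exists L (v : 'I_L * 'I_L -> K), (exists p, v p != 0) /\
    \sum_p g (v p)%:P * (x1 ^+ p.1 * x2 ^+ p.2) = 0.
Proof.
move=> [N1 [M1 [x1' [x1M x1E]]]] [N2 [M2 [x2' [x2M x2E]]]].
pose w := g (D ^+ (N1 + N2)).
have wx1 : w * x1 = g (D ^+ N2) * x1'.
  rewrite /w x1E exprD rmorphM !rmorphXn /=.
  rewrite mulrA; congr (_ * _); rewrite mulrAC [_ * z ^+ _]mulrC expr_zD mul1r //.
have wx2 : w * x2 = g (D ^+ N1) * x2'.
  rewrite /w x2E exprD rmorphM !rmorphXn /=.
  by rewrite mulrA; congr (_ * _); rewrite -mulrA [_ * z ^+ _]mulrC expr_zD mulr1.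
have [M [wM w1M w2M]] : exists M, [/\ form_bound M w,
  form_bound M (w * x1) & form_bound M (w * x2)].
  have h1 := form_boundM (form_bound_const (D ^+ N2)) x1M; rewrite -wx1 in h1.
  have h2 := form_boundM (form_bound_const (D ^+ N1)) x2M; rewrite -wx2 in h2.
  have h0 := form_bound_const (D ^+ (N1 + N2)); rewrite -/w in h0.
  exists (size (D ^+ (N1 + N2)) + ((size (D ^+ N2) + M1 + \sum_(u <- us) size u) +
           (size (D ^+ N1) + M2 + \sum_(u <- us) size u)))%N.
  by split; [apply: form_boundW h0 | apply: form_boundW h1 | apply: form_boundW h2]; lia.
(* Each of the 2L factors costs C, and L is chosen so that 2^|ys| (2LC + 1) < L^2. *)
pose C := (M + \sum_(u <- us) size u)%N.
pose L := (2 ^ size ys * (2 * C + 1)).+1.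
pose F (p : 'I_L * 'I_L) := w ^+ (2 * L) * (x1 ^+ p.1 * x2 ^+ p.2).
have FX p : form_bound ((2 * L) * C).+1 (F p).
  have [lt1 lt2] := (ltn_ord p.1, ltn_ord p.2).
  pose xs := nseq p.1 (w * x1) ++ nseq p.2 (w * x2) ++ nseq (2 * L - p.1 - p.2) w.
  have szxs : size xs = (2 * L)%N by rewrite !size_cat !size_nseq; lia.
  have -> : F p = \prod_(x <- xs) x.
    rewrite !big_cat !big_nseq !iter_mulr_1 /F !exprMn /=.
    have -> : w ^+ (2 * L) = w ^+ p.1 * w ^+ p.2 * w ^+ (2 * L - p.1 - p.2).
      by rewrite -!exprD; congr (_ ^+ _); lia.
    move: (w ^+ p.1) (w ^+ p.2) (w ^+ _) (x1 ^+ _) (x2 ^+ _) => a b c d e.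
    by ring.
  rewrite -szxs; apply: form_bound_prod => x.
  by rewrite !mem_cat !mem_nseq => /or3P[] /andP[_ /eqP ->].
have [|v v0 vF] := form_bound_dep FX.
  rewrite card_prod card_ord /L; set T := (2 ^ _)%N.
  have : (0 < T)%N by rewrite expn_gt0.
  by nia.
exists L, v; split=> //.
have : w ^+ (2 * L) * \sum_p g (v p)%:P * (x1 ^+ p.1 * x2 ^+ p.2) = 0.
  rewrite mulr_sumr -[RHS]vF; by apply: eq_bigr => p _; rewrite mulrCA.
move/(congr1 (fun x => (z ^+ (N1 + N2)) ^+ (2 * L) * x)); rewrite mulr0 mulrA -exprMn.
by rewrite /w rmorphXn expr_zD expr1n mul1r.
Qed.

End Localised.

(** * Descent of ideal membership *)

Section Ideals.
Variables (R : comNzRingType) (n m : nat) (F : 'I_m -> {mpoly R[n]}).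

Lemma in_ideal0 : in_ideal F 0.
Proof. by exists (fun _ => 0); rewrite big1 // => i _; rewrite mul0r. Qed.

Lemma in_ideal_lin a p q : in_ideal F p -> in_ideal F q -> in_ideal F (a * p + q).
Proof.
move=> [c ->] [c' ->]; exists (fun i => a * c i + c' i).
rewrite mulr_sumr -big_split; apply: eq_bigr => i _ /=.
by rewrite mulrDl mulrA.
Qed.

Lemma in_ideal_gen i : in_ideal F (F i).
Proof.
exists (fun j => (j == i)%:R); rewrite (bigD1 i) //= eqxx mul1r big1 ?addr0 //.
by move=> j /negbTE ->; rewrite mul0r.
Qed.

End Ideals.

(** A finite piece of a basis of K over E, starting with a given nonzero element. *)
Lemma free_spanning_family (E K : fieldType) (iota : {rmorphism E -> K}) (c0 : K) (s : seq K) :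
  c0 != 0 -> exists r (b : 'I_r.+1 -> K),
  [/\ b ord0 = c0,
      forall a : 'I_r.+1 -> E, \sum_l b l * iota (a l) = 0 -> forall l, a l = 0
    & forall x, x \in s -> exists a : 'I_r.+1 -> E, x = \sum_l b l * iota (a l)].
Proof.
move=> c00; elim: s => [|x s [r [b [b0 bfree bspan]]]].
  exists 0%N, (fun _ => c0); split=> // a; rewrite big_ord1 => /eqP.
  rewrite mulf_eq0 (negbTE c00) fmorph_eq0 => /eqP a0 l.
  by rewrite (ord1 l).
have [[a xa]|nx] := classic (exists a : 'I_r.+1 -> E, x = \sum_l b l * iota (a l)).
  exists r, b; split=> // y; rewrite inE => /orP[/eqP ->|]; last exact: bspan.
  by exists a.
exists r.+1, (fun l => if unlift ord_max l is Some l' then b l' else x).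
have sumE (a : 'I_r.+2 -> E) :
    \sum_l (if unlift ord_max l is Some l' then b l' else x) * iota (a l) =
    \sum_l b l * iota (a (lift ord_max l)) + x * iota (a ord_max).
  rewrite big_ord_recr /= unlift_none; congr (_ + _); apply: eq_bigr => l _.
  have -> : widen_ord (leqnSn r.+1) l = lift ord_max l.
    by apply: val_inj; rewrite /= /bump leqNgt ltn_ord.
  by rewrite liftK.
split.
- have -> : ord0 = lift ord_max ord0 :> 'I_r.+2 by apply: val_inj.
  by rewrite liftK.
- move=> a; rewrite sumE => e.
  have a1 : a ord_max = 0.
    apply/eqP/negPn/negP => a1; apply: nx.
    exists (fun l => - (a (lift ord_max l) / a ord_max)).
    have ia1 : iota (a ord_max) != 0 by rewrite fmorph_eq0.
    apply: (mulIf ia1); rewrite mulr_suml.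
    transitivity (- \sum_l b l * iota (a (lift ord_max l))).
      by apply/eqP; rewrite -addr_eq0 addrC e.
    rewrite -sumrN; apply: eq_bigr => l _.
    by rewrite -mulrA -rmorphM mulNr divfK // rmorphN mulrN.
  move: e; rewrite a1 rmorph0 mulr0 addr0 => /bfree e l.
  by case: (unliftP ord_max l) => [l' ->|-> //].
move=> y; rewrite inE => /orP[/eqP ->|/bspan[a ->]].
  exists (fun l => (l == ord_max)%:R); rewrite sumE eqxx rmorph1 mulr1 big1 ?add0r // => l _.
  by rewrite eq_sym (negbTE (neq_lift _ _)) rmorph0 mulr0.
exists (fun l => if unlift ord_max l is Some l' then a l' else 0).
rewrite sumE unlift_none rmorph0 mulr0 addr0; apply: eq_bigr => l _.
by rewrite liftK.
Qed.

(** Expand all the coefficients of the relation along a family that is free over E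
    and starts with c k0: the first coordinate of the relation is a relation over
    E, in which the coefficient of p k0 is 1. *)
Lemma in_ideal_descent (E K : fieldType) (iota : {rmorphism E -> K}) n m
    (F : 'I_m -> {mpoly E[n]}) (P : finType) (p : P -> {mpoly E[n]}) (c : P -> K) k0 :
  c k0 != 0 ->
  in_ideal (fun i => map_mpoly iota (F i)) (\sum_k (c k)%:MP * map_mpoly iota (p k)) ->
  exists2 c' : P -> E, c' k0 != 0 & in_ideal F (\sum_k (c' k)%:MP * p k).
Proof.
move=> ck0 [C CE].
pose s := [seq c k | k <- enum P] ++ flatten [seq [seq (C i)@_t | t <- msupp (C i)] | i <-
  enum 'I_m].
have [r [b [b0 bfree bspan]]] := free_spanning_family iota s ck0.
have coord (q : {mpoly K[n]}) : (forall t, t \in msupp q -> q@_t \in s) ->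
    exists q' : 'I_r.+1 -> {mpoly E[n]}, q = \sum_l (b l)%:MP * map_mpoly iota (q' l).
  move=> qs; rewrite (mpolyE q).
  have : forall t, t \in msupp q -> q@_t \in s by [].
  elim: (msupp q) => [|t ts IH] qs'.
    exists (fun=> 0); rewrite big_nil big1 // => l _; by rewrite rmorph0 mulr0.
  have [|q' q'E] := IH; first by move=> t' tts; apply: qs'; rewrite inE tts orbT.
  have [a aE] := bspan _ (qs' t (mem_head _ _)).
  exists (fun l => (a l) *: 'X_[t] + q' l); rewrite big_cons q'E aE.
  rewrite scaler_suml -big_split; apply: eq_bigr => l _ /=.
  by rewrite rmorphD /= map_mpolyZ map_mpolyX mulrDr -!mul_mpolyC mpolyCM mulrA.
have /fin_all_exists[C' C'E] : forall i, exists q' : 'I_r.+1 -> {mpoly E[n]},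
    C i = \sum_l (b l)%:MP * map_mpoly iota (q' l).
  move=> i; apply: coord => t tC; rewrite mem_cat; apply/orP; right.
  by apply/flatten_mapP; exists i; rewrite ?mem_enum //; apply: map_f.
have /fin_all_exists[c' c'E] : forall k, exists a : 'I_r.+1 -> E, c k = \sum_l b l * iota (a l).
  by move=> k; apply: bspan; rewrite mem_cat map_f ?mem_enum.
exists (fun k => c' k ord0).
  have := bfree (fun l => (l == ord0)%:R - c' k0 l).
  have -> : \sum_l b l * iota ((l == ord0)%:R - c' k0 l) = 0.
    under eq_bigr => l _ do rewrite rmorphB mulrBr.
    rewrite sumrB -c'E (bigD1 ord0) //= ?eqxx rmorph1 mulr1 b0 big1 ?addr0 ?subrr //.
    by move=> l /negbTE ->; rewrite rmorph0 mulr0.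
  move/(_ erefl ord0); rewrite eqxx => /eqP; rewrite subr_eq0 => /eqP <-.
  exact: oner_neq0.
exists (fun i => C' i ord0); apply/eqP; rewrite -subr_eq0; apply/eqP.
pose G l := \sum_k (c' k l)%:MP * p k - \sum_i C' i l * F i.
rewrite -/(G ord0); apply/mpolyP => t; rewrite mcoeff0.
apply: (bfree (fun l => (G l)@_t)).
have : \sum_l (b l)%:MP * map_mpoly iota (G l) = 0.
  rewrite /G; under eq_bigr => l _ do rewrite rmorphB !rmorph_sum mulrBr !mulr_sumr /=.
  rewrite sumrB; apply/eqP; rewrite subr_eq0; apply/eqP.
  rewrite exchange_big [RHS]exchange_big /=.
  transitivity (\sum_k (c k)%:MP * map_mpoly iota (p k)).
    apply: eq_bigr => k _; rewrite c'E raddf_sum mulr_suml; apply: eq_bigr => l _ /=.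
    by rewrite rmorphM /= map_mpolyC mpolyCM mulrA.
  rewrite CE; apply: eq_bigr => i _; rewrite {1}C'E mulr_suml; apply: eq_bigr => l _.
  by rewrite rmorphM mulrA.
move/(congr1 (mcoeff t)); rewrite mcoeff0 raddf_sum => Gt; rewrite -[RHS]Gt.
by apply: eq_bigr => l _; rewrite /= mcoeffCM mcoeff_map_mpoly.
Qed.

(** * The function ring of the curve *)

Section CurveSplit.
Variables (E : fieldType) (f D : {poly E}) (u : nat -> {poly E}).
Hypothesis f_mon : f \is monic.
Let n := (size f).-1.
Variables (K : fieldType) (iota : {rmorphism E -> K}) (rs : seq K).
Hypothesis K2 : 2%:R != 0 :> K.
Hypothesis f_split : map_poly iota f = \prod_(r <- rs) ('X - r%:P).
Hypothesis D0 : D != 0.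

(** The value at X = r of the right-hand side of the curve, as a polynomial in a. *)
Definition radicand (r : K) : {poly K} := \sum_(k < n) r ^+ k *: map_poly iota (u k).

Hypothesis u_dvd : forall r, r \in rs -> exists N, radicand r %| map_poly iota D ^+ N.
Hypothesis u_indep : square_indep (map radicand (undup rs)).

Definition curve_ideal (k : 'I_n.+1) : {mpoly K[n.+2]} :=
  map_mpoly iota (curve_eq D u k).

Definition poly_in_a : {poly K} -> {mpoly K[n.+2]} :=
  horner_eval ('X_(var_a f)) \o map_poly (@mpolyC n.+2 K).

HB.instance Definition _ := GRing.RMorphism.on poly_in_a.

Lemma poly_in_aC c : poly_in_a c%:P = c%:MP.
Proof. by rewrite /poly_in_a /= map_polyC /horner_eval hornerC. Qed.

Lemma poly_in_aX : poly_in_a 'X = 'X_(var_a f).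
Proof. by rewrite /poly_in_a /= map_polyX /horner_eval hornerX. Qed.

Lemma size_rs : size rs = n.
Proof.
have := congr1 (fun p : {poly K} => size p) f_split.
by rewrite size_map_poly size_prod_XsubC /n => ->.
Qed.

Section Point.
Variables (R : comNzRingType) (s : {rmorphism {mpoly K[n.+2]} -> R}).
Let sE : {rmorphism {mpoly E[n.+2]} -> R} := s \o map_mpoly iota.
Let e : {rmorphism K -> R} := s \o @mpolyC n.+2 K.

Lemma point_coef c : sE c%:MP = e (iota c).
Proof. by rewrite /sE /= map_mpolyC. Qed.

Lemma point_var i : sE 'X_i = s 'X_i.
Proof. by rewrite /sE /= map_mpolyX. Qed.

Lemma point_map p : map_poly (sE \o @mpolyC n.+2 E) p = map_poly e (map_poly iota p).
Proof.
rewrite -map_poly_comp; apply: eq_map_poly => c.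
exact: point_coef.
Qed.

Lemma point_at p : poly_at (sE \o @mpolyC n.+2 E) (sE 'X_(var_a f)) p
  = s (poly_in_a (map_poly iota p)).
Proof.
by rewrite /poly_at point_map point_var /poly_in_a /= /horner_eval -horner_map -[map_poly s
  _]map_poly_comp.
Qed.

Lemma point_radicand_at r : (point_radicand u sE).[e r] = s (poly_in_a (radicand r)).
Proof.
rewrite horner_poly /radicand !rmorph_sum; apply: eq_bigr => k _.
rewrite point_at mulrC -mul_polyC !rmorphM -rmorphXn; congr (_ * _).
by rewrite [RHS](congr1 s (poly_in_aC _)).
Qed.

Lemma point_f : map_poly (sE \o @mpolyC n.+2 E) f = lin_prod e rs.
Proof. by rewrite point_map f_split lin_prodE. Qed.

End Point.

(** The coordinate ring A over a field K that splits f. It embeds into the field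
    Omega obtained from K(a) by adjoining the square roots of the radicands at the
    distinct roots of f, hence it is a domain; a is transcendental, and any two
    elements are algebraically dependent. Once each function is known to be a
    power of z times a multilinear form in the square roots y_r = B(r),
    injectivity is the linear independence of [sqrt_tower]. *)
Lemma curve_function_ring : exists (A : comNzRingType) (pi : {rmorphism {mpoly K[n.+2]} -> A}),
  [/\ forall p, pi p = 0 <-> in_ideal curve_ideal p,
      forall p q, pi (p * q) = 0 -> pi p = 0 \/ pi q = 0,
      forall q, pi (poly_in_a q) = 0 -> q = 0
    & forall p1 p2, exists L (v : 'I_L * 'I_L -> K), (exists k, v k != 0) /\
       pi (\sum_k (v k)%:MP * (p1 ^+ k.1 * p2 ^+ k.2)) = 0].
Proof.
have [|Om [j [ys [ysE ysI]]]] := sqrt_tower _ (square_indep_frac u_indep).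
  by rewrite -(rmorph_nat (@FracField.tofrac {poly K} \o polyC)) fmorph_eq0.
pose G : {rmorphism {poly K} -> Om} := j \o @FracField.tofrac {poly K}.
pose e : {rmorphism K -> Om} := G \o polyC.
have G0 q : G q = 0 -> q = 0.
  by move/eqP; rewrite /G /= fmorph_eq0 tofrac_eq0 => /eqP.
have Om2 : 2%:R != 0 :> Om by rewrite -(rmorph_nat e) fmorph_eq0.
pose DK := map_poly iota D.
have DK0 : DK != 0 by rewrite map_poly_eq0.
have u0 r : r \in rs -> radicand r != 0.
  by move=> /u_dvd[N uN]; apply: dvdpN0 uN _; rewrite expf_neq0.
pose uO : {poly Om} := \poly_(k < n) G (map_poly iota (u k)).
pose rO := map e (undup rs).
pose y x := ys`_(index x rO).
have szys : size ys = size (undup rs).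
  by have := congr1 size ysE; rewrite !size_map.
have yE r : r \in rs -> y (e r) ^+ 2 = G (radicand r).
  move=> rrs; rewrite /y index_map; last exact: fmorph_inj.
  have lt : (index r (undup rs) < size (undup rs))%N by rewrite index_mem mem_undup.
  have := congr1 (fun s => s`_(index r (undup rs))) ysE.
  rewrite -!map_comp (nth_map 0) ?szys // (nth_map 0) // => ->.
  by rewrite /= nth_index ?mem_undup.
have uOr r : uO.[e r] = G (radicand r).
  rewrite horner_poly /radicand rmorph_sum; apply: eq_bigr => k _.
  by rewrite -mul_polyC rmorphM mulrC -rmorphXn.
have [||B0 [H0 [BH0 B0y]]] := @sqrt_mod_exists _ (map e rs) uO y Om2.
- by move=> _ /mapP[r rrs ->]; rewrite yE ?uOr.
- move=> _ /mapP[r rrs ->]; apply: contra (u0 r rrs) => /eqP y0.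
  by have := yE r rrs; rewrite y0 expr0n /= => /esym/G0 ->.
pose B := B0 %% lin_prod e rs.
have lpE : \prod_(r <- map e rs) ('X - r%:P) = lin_prod e rs by rewrite big_map.
rewrite lpE in BH0.
have lp0 : lin_prod e rs != 0 by rewrite -size_poly_gt0 size_lin_prod.
have [H1 BH] : exists H, B ^+ 2 - uO = lin_prod e rs * H.
  exists (H0 - (B0 %/ lin_prod e rs) * (B0 + B)); rewrite mulrBr -BH0.
  have -> : B = B0 - B0 %/ lin_prod e rs * lin_prod e rs.
    by rewrite {1}(divp_eq B0 (lin_prod e rs)) addrAC subrr add0r.
  by ring.
have By r : r \in rs -> B.[e r] = y (e r).
  move=> rrs; rewrite -B0y ?map_f // (divp_eq B0 (lin_prod e rs)) -/B !horner_ringE.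
  rewrite (_ : (lin_prod e rs).[e r] = 0) ?mulr0 ?add0r //.
  rewrite horner_lin_prod (_ : \prod_(_ <- _) _ = 0) ?rmorph0 //.
  by apply/eqP; rewrite prodf_seq_eq0; apply/hasP; exists r; rewrite //= subrr.
have szB : (size B <= n)%N by rewrite -ltnS -size_rs -(size_lin_prod e) ltn_modpN0.
(* The point of the curve with coordinate a = X in Omega. *)
pose h (i : 'I_n.+2) : Om := if i == 0%N :> nat then G 'X else
   if i == 1%N :> nat then (G DK)^-1 else B`_(i - 2).
pose phi : {rmorphism {mpoly K[n.+2]} -> Om} := mmap e h.
have phiC c : phi c%:MP = e c by rewrite /phi /= mmapC.
have phiX i : phi 'X_i = h i by rewrite /phi /= mmapX mmap1U.
have phia q : phi (poly_in_a q) = G q.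
  rewrite /poly_in_a /= /horner_eval -horner_map /= -map_poly_comp phiX /h /=.
  have -> : map_poly (phi \o @mpolyC n.+2 K) q = map_poly e q.
    by apply: eq_map_poly => c; rewrite /= phiC.
  elim/poly_ind: q => [|q c IH]; first by rewrite !rmorph0 horner0.
  by rewrite !rmorphD !rmorphM /= map_polyX map_polyC !horner_ringE IH.
have phi_curve k : phi (curve_ideal k) = 0.
  move: k; have [_] := curve_points D u f_mon (phi \o map_mpoly iota); apply.
  rewrite point_var phiX point_at phia point_f; split.
    by rewrite /h inordK //= mulVf //; apply: contra DK0 => /eqP/G0 ->.
  exists H1.
  have -> : point_root (phi \o map_mpoly iota) = B.
    apply/polyP => i; rewrite coef_poly; case: ltnP => lin.
      by rewrite insubT point_var phiX /h /var_b inordK //= subn2.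
    by rewrite nth_default // (leq_trans szB).
  have -> : point_radicand u (phi \o map_mpoly iota) = uO.
    by apply/polyP => k; rewrite !coef_poly point_at phia.
  rewrite BH; congr (_ * _); rewrite /lin_prod; apply: eq_bigr => r _.
  by congr ('X - _%:P); rewrite /= phiC.
have phi_ideal p : in_ideal curve_ideal p -> phi p = 0.
  by case=> c ->; rewrite rmorph_sum big1 // => k _; rewrite rmorphM phi_curve mulr0.
have [|||A [pi [pi0 pi_surj]]] := @quotient_ring _ (in_ideal curve_ideal).
- exact: in_ideal0.
- by move/phi_ideal/eqP; rewrite rmorph1 oner_eq0.
- exact: in_ideal_lin.
exists A, pi.
have pi_curve k : pi (curve_ideal k) = 0 by apply/pi0/in_ideal_gen.
have [cp _] := curve_points D u f_mon (pi \o map_mpoly iota).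
have [zD [H BHA]] := cp pi_curve.
rewrite point_var point_at in zD; rewrite point_f in BHA.
pose eA : {rmorphism K -> A} := pi \o @mpolyC n.+2 K.
pose gA : {rmorphism {poly K} -> A} := pi \o poly_in_a.
rewrite -/eA in BHA; set z := pi 'X_(var_z f) in zD.
set BA := point_root _ in BHA; set uA := point_radicand _ _ in BHA.
have eAg c : eA c = gA c%:P.
  by rewrite [RHS](congr1 pi (poly_in_aC _)).
(* The polynomial function B(r), which is the square root of the radicand at r. *)
pose yP r : {mpoly K[n.+2]} := \sum_(j < n) (r ^+ j)%:MP * 'X_(var_b j).
have yPA r : pi (yP r) = BA.[eA r].
  rewrite /BA point_rootE horner_sum rmorph_sum; apply: eq_bigr => i _.
  by rewrite hornerZ hornerXn point_var rmorphM mulrC -rmorphXn.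
have yPO r : r \in rs -> phi (yP r) = y (e r).
  move=> rrs; rewrite -By // (horner_coef_wide _ szB) rmorph_sum; apply: eq_bigr => i _.
  rewrite rmorphM phiC phiX /h /var_b inordK ?ltnS //= ?subn2 mulrC; congr (_ * _).
  exact: (rmorphXn e).
pose ysP := map yP (undup rs).
have ysPA : map (fun y => y ^+ 2) (map pi ysP) = map gA (map radicand (undup rs)).
  rewrite /ysP -!map_comp; apply/eq_in_map => r; rewrite mem_undup => rrs /=.
  rewrite yPA -[RHS](point_radicand_at pi) -/eA -/uA.
  have := congr1 (fun p => p.[eA r]) BHA; rewrite !horner_ringE horner_lin_prod.
  rewrite (_ : \prod_(_ <- _) _ = 0) ?rmorph0 ?mul0r; first by move/eqP; rewrite subr_eq0 => /eqP.
  by apply/eqP; rewrite prodf_seq_eq0; apply/hasP; exists r; rewrite //= subrr.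
have ysPO : map phi ysP = ys.
  apply: (@eq_from_nth _ 0); first by rewrite !size_map szys.
  move=> i; rewrite !size_map => lti; rewrite /ysP (nth_map 0) ?size_map // (nth_map 0) //.
  rewrite yPO; last by rewrite -mem_undup mem_nth.
  rewrite /y index_map; last exact: fmorph_inj.
  by rewrite index_uniq ?undup_uniq.
(* Every function is a power of z times a multilinear form in the B(r). *)
pose red := has_form gA (map pi ysP) z.
have redM x x' : red x -> red x' -> red (x * x') := has_formM ysPA (x := x) (y := x').
have redD x x' : red x -> red x' -> red (x + x') := has_formD ysPA zD (x := x) (y := x').
have redg q : red (gA q) by apply: has_form_const.
have redC c : red (eA c) by rewrite eAg.
have redz : red z by apply: has_form_z.
have redX x k : red x -> red (x ^+ k).
  by move=> rx; elim: k => [|k IH]; rewrite ?exprS; [rewrite expr0 -(rmorph1 eA) | apply/redM].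
have redB : coefs_in red BA.
  apply: (@sqrt_coefs_in _ _ eA red redD redM redC rs BA uA H K2 BHA).
  - move=> i; rewrite coef_poly; case: ifP => _; last by rewrite -(rmorph0 eA).
    by rewrite point_at; apply/redg.
  - by rewrite size_rs; apply: size_poly.
  - move=> r rrs; apply: (@form_bound_has_form _ _ gA (map pi ysP) z 1).
    by apply: form_bound_var; rewrite -yPA map_f // map_f // mem_undup.
  move=> r rrs; have [N /dvdpP[q qE]] := u_dvd rrs.
  have yr2 : BA.[eA r] * BA.[eA r] = gA (radicand r).
    have := congr1 (fun s => s`_(index r (undup rs))) ysPA.
    have lt : (index r (undup rs) < size (undup rs))%N by rewrite index_mem mem_undup.
    rewrite !(nth_map 0) ?size_map // nth_index ?mem_undup //.
    by rewrite yPA expr2.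
  (* B(r)^2 is the radicand, which divides a power of D, whose inverse is a power of z. *)
  exists (BA.[eA r] * (gA q * z ^+ N)).
    apply/redM; last by apply/redM; [apply/redg | apply: redX].
    apply: (@form_bound_has_form _ _ gA (map pi ysP) z 1).
    by apply: form_bound_var; rewrite -yPA map_f // map_f // mem_undup.
  by rewrite mulrA yr2 mulrA -rmorphM mulrC [radicand r * q]mulrC -qE rmorphXn -exprMn zD expr1n.
have red_all p : red (pi p).
  elim/mpolyind: p => [|c m p _ _ IH]; first by rewrite rmorph0 -(rmorph0 eA).
  rewrite rmorphD -mul_mpolyC rmorphM; apply/redD/IH/redM; first exact: redC.
  rewrite mpolyXE_id rmorph_prod; apply: (big_ind red) => //.
    by rewrite -(rmorph1 eA).
  move=> i _; rewrite rmorphXn; apply: redX.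
  case: i => [[|[|i]] lti].
  - have -> : Ordinal lti = var_a f by apply: val_inj.
    have := redg 'X; rewrite /gA /= poly_in_aX; exact.
  - have -> : Ordinal lti = var_z f by apply: val_inj; rewrite /= inordK.
    exact: redz.
  have ltin : (i < n)%N by rewrite -2!ltnS.
  have := redB i; rewrite coef_poly ltin insubT point_var.
  by congr (red (pi 'X_ _)); apply: val_inj; rewrite /= inordK.
(* A form that vanishes in Omega has zero coefficients, so the kernel of phi is the
   ideal of the curve. *)
have ker p : phi p = 0 -> pi p = 0.
  have [N [M [x' [[c cM x'E] pE]]]] := red_all p.
  pose p' := 'X_(var_z f) ^+ N * multilin poly_in_a ysP c.
  have pp' : pi p = pi p'.
    rewrite pE x'E /p' rmorphM rmorphXn; congr (_ * _).
    by rewrite (rmorph_multilin _ pi); apply: eq_multilin.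
  have : phi p = phi p'.
    apply/eqP; rewrite -subr_eq0 -rmorphB; apply/eqP/phi_ideal/pi0.
    by rewrite rmorphB pp' subrr.
  move=> -> /eqP; rewrite /p' rmorphM rmorphXn mulf_eq0 expf_eq0.
  rewrite phiX /h inordK //= invr_eq0 (negbTE (_ : G DK != 0)) ?andbF /=; last first.
    by apply: contra DK0 => /eqP/G0 ->.
  rewrite (rmorph_multilin _ phi) ysPO => /eqP ev0.
  have c0 m : size m = size (undup rs) -> c m = 0.
    move=> szm; apply/eqP; rewrite -tofrac_eq0; apply/eqP.
    apply: (ysI (fun m => (c m)%:F)); last by rewrite !size_map.
    by rewrite -[RHS]ev0; apply: eq_multilin => m'; rewrite /= phia.
  rewrite pE x'E multilin_eq0 ?mulr0 // => m; rewrite !size_map; exact: c0.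
have pi_phi p : pi p = 0 -> phi p = 0 by move/pi0/phi_ideal.
split=> //.
- move=> p q /pi_phi/eqP; rewrite rmorphM mulf_eq0 => /orP[] /eqP/ker; [left|right]; by [].
- by move=> q /pi_phi; rewrite phia => /G0.
move=> p1 p2.
have [L [v [v0 vE]]] := has_form_alg_dep ysPA zD (red_all p1) (red_all p2).
exists L, v; split=> //; rewrite rmorph_sum -[RHS]vE; apply: eq_bigr => k _.
by rewrite !rmorphM !rmorphXn -eAg.
Qed.

End CurveSplit.

(** * Rational points of the curve *)

Lemma mpoly1_poly (E : comNzRingType) (R : comNzRingType)
    (e : {rmorphism E -> R}) (p : {mpoly E[1]}) :
  exists2 q : {poly E}, (q = 0 -> p = 0) &
    forall h, mmap e h p = (map_poly e q).[h ord0].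
Proof.
pose q : {poly E} := mmap polyC (fun=> 'X) p; exists q; last first.
  move=> h; have := @mpoly_morph_ext E R 1 (mmap e h)
     (horner_eval (h ord0) \o map_poly e \o mmap polyC (fun=> 'X)); apply.
    by move=> c; rewrite /= !mmapC /horner_eval map_polyC hornerC.
  by move=> i; rewrite /= !mmapX !mmap1U map_polyX /horner_eval hornerX (ord1 i).
move=> q0.
have := @mpoly_morph_ext E {mpoly E[1]} 1 idfun
   (horner_eval 'X_0 \o map_poly (@mpolyC 1 E) \o mmap polyC (fun=> 'X)).
move=> ext; have := ext _ _ p.
rewrite /= -/q q0 rmorph0 /horner_eval horner0; apply.
  by move=> c; rewrite /= mmapC map_polyC hornerC.
by move=> i; rewrite /= mmapX mmap1U map_polyX hornerX (ord1 i).
Qed.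

Section PACCurve.
Variables (E : fieldType) (f D : {poly E}) (u : nat -> {poly E}).
Hypothesis E2 : 2%:R != 0 :> E.
Hypothesis pac : pseudo_algebraically_closed E.
Hypothesis f_mon : f \is monic.
Hypothesis D0 : D != 0.
Hypothesis radicands_indep : forall (K : fieldType) (iota : {rmorphism E -> K}) rs,
  map_poly iota f = \prod_(r <- rs) ('X - r%:P) ->
  (forall r, r \in rs -> exists N, radicand f u iota r %| map_poly iota D ^+ N) /\
  square_indep (map (radicand f u iota) (undup rs)).

Lemma curve_prime (K : fieldType) (iota : {rmorphism E -> K}) rs :
  map_poly iota f = \prod_(r <- rs) ('X - r%:P) ->
  ideal_prime (curve_ideal (f := f) D u iota).
Proof.
move=> fs; have [ud ui] := radicands_indep fs.
have K2 : 2%:R != 0 :> K by rewrite -(rmorph_nat iota) fmorph_eq0.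
have [A [pi [pi0 piM _ _]]] := curve_function_ring f_mon K2 fs D0 ud ui.
split=> [/pi0/eqP|p q /pi0/piM]; first by rewrite rmorph1 oner_eq0.
by case=> /pi0; [left|right].
Qed.

(** The coordinate a is transcendental. A relation between two functions exists
    over a splitting field K of f and descends to E. *)
Lemma curve_dim (K : fieldType) (iota : {rmorphism E -> K}) rs :
  map_poly iota f = \prod_(r <- rs) ('X - r%:P) ->
  locus_dim (curve_eq (f := f) D u) 1.
Proof.
move=> fs; have [ud ui] := radicands_indep fs.
have K2 : 2%:R != 0 :> K by rewrite -(rmorph_nat iota) fmorph_eq0.
have [A [pi [pi0 _ pia pidep]]] := curve_function_ring f_mon K2 fs D0 ud ui.
have idealK p : in_ideal (curve_eq (f := f) D u) p -> pi (map_mpoly iota p) = 0.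
  case=> c ->; rewrite [map_mpoly _ _]rmorph_sum [pi _]rmorph_sum /= big1 // => k _;
    rewrite !rmorphM /=.
  have /pi0 -> := in_ideal_gen (curve_ideal (f := f) D u iota) k.
  by rewrite mulr0.
split.
  exists [tuple 'X_(var_a f)] => p /idealK.
  have [q q0 qE] := mpoly1_poly (pi \o map_mpoly iota \o @mpolyC _ E) p.
  have -> : pi (map_mpoly iota (p \mPo [tuple 'X_(var_a f)])) =
      mmap (pi \o map_mpoly iota \o @mpolyC _ E) (fun=> pi 'X_(var_a f)) p.
    pose s : {rmorphism {mpoly E[1]} -> A} := pi \o map_mpoly iota \o comp_mpoly [tuple
      'X_(var_a f)].
    apply: (@mpoly_morph_ext _ _ _ s) => [c|i].
      by rewrite /= mmapC comp_mpolyC.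
    by rewrite (ord1 i) /= mmapX mmap1U comp_mpolyXU /= map_mpolyX.
  rewrite qE => e; apply/q0/eqP; rewrite -(map_poly_eq0 iota); apply/eqP/pia.
  rewrite -[RHS]e /poly_in_a /= /horner_eval -horner_map; congr _.[_].
  rewrite -!map_poly_comp; apply: eq_map_poly => c /=; congr (pi _).
  by rewrite map_mpolyC.
case=> t ind; pose p1 := tnth t ord0; pose p2 := tnth t ord_max.
have [L [v [[k0 vk0] vE]]] := pidep (map_mpoly iota p1) (map_mpoly iota p2).
move/pi0: vE.
under eq_bigr => k _ do rewrite -!rmorphXn -rmorphM.
case/(in_ideal_descent vk0) => v' v'k0.
pose mon (k : 'I_L * 'I_L) : {mpoly E[2]} := 'X_ord0 ^+ k.1 * 'X_ord_max ^+ k.2.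
pose P := \sum_k (v' k)%:MP * mon k.
have -> : \sum_k (v' k)%:MP * (p1 ^+ k.1 * p2 ^+ k.2) = P \mPo t.
  rewrite rmorph_sum; apply: eq_bigr => k _.
  by rewrite !rmorphM !rmorphXn /= comp_mpolyC !comp_mpolyXU -!tnth_nth.
move/ind => P0; move/eqP: v'k0; apply.
have monE k : mon k = 'X_[[multinom (if i == ord0 then k.1 : nat else k.2 : nat) | i < 2]].
  by rewrite mpolyXE_id 2!big_ord_recl big_ord0 mulr1 !mnmE /= /mon;
    congr (_ * 'X_ _ ^+ _); apply: val_inj.
have := congr1 (mcoeff [multinom (if i == ord0 then k0.1 : nat else k0.2 : nat) | i < 2]) P0.
rewrite mcoeff0 raddf_sum (bigD1 k0) //= mcoeffCM monE mcoeffX eqxx mulr1 big1 ?addr0 // => k kk0.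
rewrite mcoeffCM monE mcoeffX; case: eqP => [e|]; last by rewrite mulr0.
case/eqP: kk0; move: e => /mnmP e; move: (e ord0) (e ord_max); rewrite !mnmE /= => e1 e2.
by apply/eqP; rewrite -pair_eqE /= -!val_eqE /= e1 e2 !eqxx.
Qed.

(** Over an algebraic closure f splits, so [curve_prime] applies; the dimension
    can be computed over any splitting field. *)
Lemma PAC_sqrt : exists (a : E) (B : {poly E}), D.[a] != 0 /\
  f %| B ^+ 2 - \poly_(k < (size f).-1) (u k).[a].
Proof.
have [K [iota [rs]]] := split_exists (monic_neq0 f_mon).
rewrite (monicP f_mon) rmorph1 scale1r => fs.
have [||x xF] := @pac _ _ (curve_eq (f := f) D u).
- move=> L iL _; have [rs' fs'] := closed_field_poly_normal (map_poly iL f).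
  rewrite lead_coef_map (monicP f_mon) rmorph1 scale1r in fs'.
  exact: curve_prime fs'.
- exact: curve_dim fs.
have [cp _] := curve_points D u f_mon (meval x).
have [zD [H BH]] := cp xF.
have idE p : map_poly (meval x \o @mpolyC _ E) p = p.
  by rewrite map_poly_id // => c _; rewrite /= mevalC.
exists (meval x 'X_(var_a f)), (point_root (meval x)); split.
  apply/eqP => Da; move/eqP: zD; rewrite /poly_at idE Da mulr0 eq_sym.
  by rewrite oner_eq0.
apply/dvdpP; exists H; rewrite mulrC -[X in X * _]idE -BH; congr (_ - _).
by apply/polyP => k; rewrite !coef_poly /poly_at idE.
Qed.

End PACCurve.

(** * Square-free polynomials are not squares over an extension *)

(** The coefficient of degree d + j of w^2 is 2 w_j plus terms in the coefficients
    of w of degree between j and d only (those with an index above d vanish); the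
    coefficients of w are thus determined from the top. *)
Lemma coef_sqr_upper (K : fieldType) (w : {poly K}) d j :
  w \is monic -> size w = d.+1 -> (j < d)%N ->
  (w ^+ 2)`_(d + j) = 2%:R * w`_j +
    \sum_(i < (d + j).+1 | (i != j :> nat) && (i != d :> nat)) w`_i * w`_(d + j - i).
Proof.
move=> wm szw jd; rewrite expr2 coefM.
have jlt : (j < (d + j).+1)%N by lia.
have dlt : (d < (d + j).+1)%N by lia.
rewrite (bigD1 (Ordinal jlt)) //= (bigD1 (Ordinal dlt)) /=; last by rewrite -val_eqE /=; lia.
have wd : w`_d = 1 by move/monicP: wm; rewrite /lead_coef szw.
rewrite addnK addKn wd mulr1 mul1r addrA mulr_natl mulr2n; congr (_ + _).
Qed.

Lemma monic_sqrt_descends (E K : fieldType) (iota : {rmorphism E -> K})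
    (g : {poly E}) (w : {poly K}) :
  2%:R != 0 :> E -> w \is monic -> map_poly iota g = w ^+ 2 ->
  exists w0, g = w0 ^+ 2.
Proof.
move=> E2 wm gw.
pose Im x := exists c, x = iota c.
have Im0 : Im 0 by exists 0; rewrite rmorph0.
have ImD x y : Im x -> Im y -> Im (x + y) by move=> [a ->] [b ->]; exists (a + b);
  rewrite rmorphD.
have ImM x y : Im x -> Im y -> Im (x * y) by move=> [a ->] [b ->]; exists (a * b);
  rewrite rmorphM.
have [d szw] : exists d, size w = d.+1.
  by exists (size w).-1; rewrite prednK // size_poly_gt0 monic_neq0.
have Imw : forall j, Im w`_j.
  move=> j; have [k] := ubnP (d - j); elim: k j => // k IH j lek.
  have [ltj|] := ltnP j d; last first.
    rewrite leq_eqVlt => /orP[/eqP <-|ltj]; last by rewrite nth_default // szw.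
    by exists 1; rewrite rmorph1; move/monicP: wm; rewrite /lead_coef szw.
  have e := coef_sqr_upper wm szw ltj.
  have -> : w`_j = iota (2%:R)^-1 * (iota g`_(d + j) + iota (-1) *
      \sum_(i < (d + j).+1 | (i != j :> nat) && (i != d :> nat)) w`_i * w`_(d + j - i)).
    rewrite -coef_map gw e rmorphN1 mulN1r addrK mulrA -(rmorph_nat iota) -rmorphM.
    by rewrite mulVf // rmorph1 mul1r.
  apply/ImM; first by eexists.
  apply/ImD; first by eexists.
  apply/ImM; first by eexists.
  apply: (big_ind Im) => // i /andP[ij id].
  have [lij|lji] := leqP i j.
    by rewrite [w`_(_ - _)]nth_default ?mulr0 // szw; lia.
  have [lid|ldi] := leqP d i.
    by rewrite nth_default ?mul0r // szw; lia.
  by apply/ImM; apply: IH; lia.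
have /fin_all_exists[c cE] : forall i : 'I_(size w), exists c, w`_i = iota c by move=> i;
  apply: Imw.
pose w0 := \poly_(i < size w) (if insub i is Some i' then c i' else 0).
exists w0; apply: (map_poly_inj iota); rewrite gw rmorphXn /=; congr (_ ^+ 2).
apply/polyP => i; rewrite coef_map coef_poly; case: ltnP => szi.
  by rewrite insubT; apply: (cE (Ordinal szi)).
by rewrite nth_default //; apply: esym; apply: rmorph0.
Qed.

(** Square-freeness over E may be lost over an extension when f is inseparable,
    but a square root of f over the extension would, once monic, already be
    defined over E. *)
Lemma square_free_not_square (E K : fieldType) (iota : {rmorphism E -> K})
    (f : {poly E}) (w : {poly K}) :
  2%:R != 0 :> E -> (1 < size f)%N -> square_free f -> map_poly iota f != w ^+ 2.
Proof.
move=> E2 f_gt1 sf; apply/eqP => fw.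
have f0 : f != 0 by rewrite -size_poly_gt0 ltnW.
have lf0 : lead_coef f != 0 by rewrite lead_coef_eq0.
have lw : lead_coef w ^+ 2 = iota (lead_coef f) by rewrite -lead_coef_map fw lead_coef_exp.
have lw0 : lead_coef w != 0.
  by apply: contra lf0 => /eqP l0; rewrite -(fmorph_eq0 iota) -lw l0 expr0n.
have [||w0 e] := @monic_sqrt_descends E K iota ((lead_coef f)^-1 *: f) ((lead_coef w)^-1 *: w) E2.
- by rewrite monicE lead_coefZ mulVf.
- by rewrite map_polyZ fw exprZn exprVn lw fmorphV.
have /sf/is_unit_poly sz1 : f = w0 ^+ 2 * (lead_coef f)%:P.
  by rewrite -e mulrC mul_polyC scalerA mulfV // scale1r.
have := congr1 (fun p : {poly E} => size p) e; rewrite size_scale ?invr_eq0 //.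
move=> szf; move: f_gt1; rewrite szf expr2 ltnNge.
by rewrite (leq_trans (size_polyMleq _ _)) // sz1.
Qed.

(** * Pseudo-algebraically closed fields *)

Section PAC.
Variable E : fieldType.
Hypothesis E2 : 2%:R != 0 :> E.
Hypothesis pac : pseudo_algebraically_closed E.

(** The curve b^2 = f(a), obtained with modulus X, for which B is a constant. *)
Lemma pac_square_value (f : {poly E}) : (1 < size f)%N -> square_free f ->
  exists a s, f.[a] = s ^+ 2 /\ s != 0.
Proof.
move=> f_gt1 sf; have f0 : f != 0 by rewrite -size_poly_gt0 ltnW.
have [|a [B [fa /dvdpP[H BH]]]] := @PAC_sqrt E 'X f (fun=> f) E2 pac (monicX _) f0.
  move=> K iota rs Xrs.
  have uE r : radicand 'X (fun=> f) iota r = map_poly iota f.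
    by rewrite /radicand size_polyX big_ord1 expr0 scale1r.
  split=> [r _|]; first by exists 1%N; rewrite uE expr1.
  have : size rs = 1%N.
    have := congr1 (fun p : {poly K} => size p) Xrs.
    by rewrite size_map_poly size_polyX size_prod_XsubC => -[].
  case: rs Xrs => [|r [|]] //= Xrs _ [|[] [|]] //= _ _ w.
  by rewrite big_seq1 uE square_free_not_square.
exists a, B.[0]; have := congr1 (fun p => p.[0]) BH.
rewrite !horner_ringE mulr0 size_polyX => /eqP; rewrite subr_eq0 => /eqP e.
have fae : f.[a] = B.[0] ^+ 2.
  by rewrite expr2 e horner_poly big_ord1 expr0 mulr1.
by split=> //; apply: contra fa => /eqP B00; rewrite fae B00 expr0n.
Qed.

(** With b the inverse of p modulo f, the radicand at a root r is b(r) * (a - r).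
    A product of these over distinct roots has simple zeros, so it is not a
    square. *)
Lemma pac_linear (f p : {poly E}) : (1 < size f)%N -> coprimep f p ->
  exists a B, f.[a] != 0 /\ f %| p * B ^+ 2 - (a%:P - 'X).
Proof.
move=> f_gt1 /Bezout_eq1_coprimepP[[k b] /= bez].
have f0 : f != 0 by rewrite -size_poly_gt0 ltnW.
have lf0 : (lead_coef f)^-1 != 0 by rewrite invr_eq0 lead_coef_eq0.
pose fm := (lead_coef f)^-1 *: f.
have fmm : fm \is monic by rewrite monicE lead_coefZ mulVf // lead_coef_eq0.
have fmf q : (fm %| q) = (f %| q) by rewrite dvdpZl.
pose u k := (b %% f)`_k *: 'X - (((b * 'X) %% f)`_k)%:P.
have [|a [B [fa fB]]] := @PAC_sqrt E fm f u E2 pac fmm f0.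
  move=> K iota rs fs.
  have root_f r : r \in rs -> (map_poly iota f).[r] = 0.
    move=> rrs; have : (map_poly iota fm).[r] = 0.
      rewrite fs horner_prod; apply/eqP; rewrite prodf_seq_eq0; apply/hasP.
      by exists r; rewrite //= !horner_ringE subrr.
    rewrite map_polyZ hornerZ => /eqP; rewrite mulf_eq0 fmorph_eq0 (negbTE lf0).
    by move/eqP.
  have mod_f q r : r \in rs -> \sum_(k < (size fm).-1) r ^+ k * iota (q %% f)`_k
    = (map_poly iota q).[r].
    move=> rrs; rewrite [in RHS](divp_eq q f) rmorphD rmorphM !horner_ringE root_f // mulr0 add0r.
    rewrite (@horner_coef_wide _ (size fm).-1); last first.
      by rewrite size_map_poly size_scale // -ltnS prednK ?size_poly_gt0 // ltn_modpN0.
    by apply: eq_bigr => i _; rewrite coef_map mulrC.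
  have uE r : r \in rs -> radicand fm u iota r = (map_poly iota b).[r] *: ('X - r%:P).
    move=> rrs; rewrite /radicand /u.
    under eq_bigr => i _ do rewrite rmorphB /= map_polyZ map_polyX map_polyC scalerBr
       scalerA -[_ *: (iota _)%:P]mul_polyC -polyCM.
    rewrite sumrB -scaler_suml -rmorph_sum mod_f // mod_f //.
    by rewrite rmorphM /= map_polyX !horner_ringE scalerBr polyCM mul_polyC.
  have b0 r : r \in rs -> (map_poly iota b).[r] != 0.
    move=> rrs; apply/eqP => br.
    have := congr1 (fun q => (map_poly iota q).[r]) bez.
    rewrite rmorphD !rmorphM rmorph1 !horner_ringE root_f // br mulr0 mul0r addr0 => /eqP.
    by rewrite eq_sym oner_eq0.
  split=> [r rrs|m].
    exists 1%N; rewrite expr1 uE // dvdpZl ?b0 // dvdp_XsubCl /root root_f //.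
  rewrite size_map -map_mask => szm hasm w.
  have := mask_uniq (undup_uniq rs) m.
  have subm : {subset mask m (undup rs) <= rs}.
    by move=> x /mem_mask; rewrite mem_undup.
  have : mask m (undup rs) != [::].
    by rewrite -size_eq0 size_mask // -lt0n -has_count.
  case: (mask m (undup rs)) subm => // r S subm _ /= /andP[rS _].
  have rrs : r \in rs by apply: subm; rewrite mem_head.
  apply/eqP; rewrite big_cons uE // => e.
  have /factor_theorem[w' w'E] : root w r.
    have : (w ^+ 2).[r] == 0 by rewrite -e hornerM hornerZ !horner_ringE subrr mulr0 mul0r.
    by rewrite horner_exp expf_eq0.
  have X0 : 'X - r%:P != 0 by rewrite polyXsubC_eq0.
  have {}e : (map_poly iota b).[r] *: \prod_(j <- [seq radicand fm u iota i | i <- S]) j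
    = w' ^+ 2 * ('X - r%:P).
    by apply: (mulIf X0); rewrite -mulrA -expr2 -exprMn -w'E -e -scalerAl mulrC -scalerAl.
  have := congr1 (fun q => q.[r]) e; rewrite hornerZ !horner_ringE subrr mulr0.
  move/eqP; rewrite mulf_eq0 (negbTE (b0 r rrs)) big_map horner_prod prodf_seq_eq0.
  case/hasP=> s sS /=; have srs : s \in rs by apply: subm; rewrite inE sS orbT.
  rewrite uE // hornerZ !horner_ringE mulf_eq0 (negbTE (b0 s srs)) subr_eq0 => /eqP rs'.
  by rewrite rs' sS in rS.
exists a, B; split=> //; rewrite fmf in fB.
have -> : p * B ^+ 2 - (a%:P - 'X) = p * (B ^+ 2 - b * (a%:P - 'X)) - f * (k * (a%:P - 'X)).
  have -> : f * (k * (a%:P - 'X)) = (1 - b * p) * (a%:P - 'X) by rewrite -bez; ring.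
  by ring.
apply: dvdp_sub; last exact: dvdp_mulr.
apply: dvdp_mull.
have -> : B ^+ 2 - b * (a%:P - 'X) = (B ^+ 2 - (b * (a%:P - 'X)) %% f) - (b * (a%:P - 'X))
  %/ f * f.
  by rewrite {1}(divp_eq (b * (a%:P - 'X)) f); ring.
apply: dvdp_sub; last exact: dvdp_mull.
move: fB; congr (_ %| _ - _); apply/polyP => i; rewrite coef_poly.
have -> : b * (a%:P - 'X) = a *: b - b * 'X by rewrite -mul_polyC; ring.
rewrite modpD modNp modpZl coefB coefZ; case: ltnP => szi.
  by rewrite /u !(horner_ringE, hornerZ) mulrC.
have le : (size f <= i.+1)%N by rewrite -(prednK (ltnW f_gt1)) ltnS -(size_scale f lf0).
rewrite !nth_default ?mulr0 ?subr0 // -ltnS; apply: leq_trans le; exact: ltn_modpN0.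
Qed.

Lemma coprimep_subX (f : {poly E}) a : coprimep f (a%:P - 'X) = (f.[a] != 0).
Proof.
rewrite -(coprimepZr _ _ (c := -1)) ?oppr_eq0 ?oner_eq0 // scaleN1r opprB.
by rewrite coprimep_XsubC.
Qed.

Lemma coprimep_root_value (f p B : {poly E}) a : coprimep f p -> f.[a] != 0 ->
  f %| p * B ^+ 2 - (a%:P - 'X) -> coprimep f B.
Proof.
move=> fp fa fB; have : coprimep f (p * B ^+ 2).
  apply: coprimep_sub_dvd (_ : coprimep f (a%:P - 'X)); last by rewrite coprimep_subX.
  by rewrite -opprB dvdpNr.
by rewrite coprimepMr => /andP[_]; rewrite coprimep_pexpr.
Qed.

Lemma subX_neq0 (a : E) : a%:P - 'X != 0.
Proof. by rewrite -opprB oppr_eq0 polyXsubC_eq0. Qed.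

Lemma PAC_square_reflexive : square_reflexive E.
Proof.
move=> f f0 sf alpha ua hN.
have [f_le1|f_gt1] := leqP (size f) 1; first exact: square_reflexive_const.
have lf0 : lead_coef f != 0 by rewrite lead_coef_eq0.
have [p palpha] := to_quot_surj alpha; subst alpha.
have fp : coprimep f p by apply/is_unit_to_quot.
(* Norms of both sides of q B^2 = a - X. *)
have value a q B : coprimep f q -> f.[a] != 0 -> f %| q * B ^+ 2 - (a%:P - 'X) ->
    f.[a] = lead_coef f * normp f q * normp f B ^+ 2.
  move=> fq fa fB; rewrite -mulrA expr2 -!normpM -expr2.
  by rewrite (normp_eq f0 fB) normp_subX // mulVKf.
case: hN => [[y _ Np]|[c [y yu cE] Np]]; last first.
  have [a [B [fa fB]]] := pac_linear f_gt1 fp.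
  have cop : coprimep f (a%:P - 'X) by rewrite coprimep_subX.
  have fBc := coprimep_root_value fp fa fB.
  exists (a%:P - 'X); split; [exact: subX_neq0|by rewrite coprimep_sym|exact:
    reflexive_witness fB|].
  pose s := lead_coef f * y * normp f B.
  have fas : f.[a] = s ^+ 2.
    by rewrite (value a p B) // [normp f p]Np cE /s; ring.
  have s0 : s != 0 by move: fa; rewrite fas expf_eq0.
  apply: (@unit_square_to_quot _ _ _ s%:P); first exact: subX_neq0.
    by rewrite -(alg_polyC s) coprimepZr // coprimep1.
  by rewrite -polyC_exp -fas -opprB dvdpNl dvdp_XsubCl /root !horner_ringE subrr.
have [a1 [s1 [fa1 s10]]] := pac_square_value f_gt1 sf.
have fa10 : f.[a1] != 0 by rewrite fa1 expf_neq0.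
have cop1 : coprimep f (a1%:P - 'X) by rewrite coprimep_subX.
have fq : coprimep f (p * (a1%:P - 'X)) by rewrite coprimepMr fp.
have [a2 [B [fa20 fB]]] := pac_linear f_gt1 fq.
have cop2 : coprimep f (a2%:P - 'X) by rewrite coprimep_subX.
have fBc := coprimep_root_value fq fa20 fB.
have [a12|a12] := eqVneq a1 a2.
  exists 1; split; rewrite ?oner_eq0 ?coprime1p //.
    apply: (@reflexive_witness _ _ _ B) => //; first by rewrite coprimep1.
    rewrite -(Gauss_dvdpl _ cop1) mulrBl mul1r; move: fB; rewrite -a12.
    by congr (_ %| _ - _); ring.
  exists 1; last by apply: polyquot_trivial; rewrite size_poly1.
  by exists 1; rewrite mulr1.
pose s2 := y * s1 * normp f B.
have fa2 : f.[a2] = s2 ^+ 2.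
  rewrite (value a2 (p * (a1%:P - 'X)) B) // normpM [normp f p]Np normp_subX // fa1 /s2.
  by field.
have s20 : s2 != 0 by move: fa20; rewrite fa2 expf_eq0.
pose g := (a1%:P - 'X) * (a2%:P - 'X).
have g0 : g != 0 by rewrite mulf_neq0 ?subX_neq0.
have copg : coprimep f g by rewrite coprimepMr cop1 cop2.
have cop12 : coprimep (a1%:P - 'X) (a2%:P - 'X).
  by rewrite coprimep_subX !horner_ringE subr_eq0.
exists g; split=> //; first by rewrite coprimep_sym.
  apply: (@reflexive_witness _ _ _ ((a1%:P - 'X) * B)) => //.
    by rewrite coprimepMr cop1 fBc.
  have -> : p * ((a1%:P - 'X) * B) ^+ 2 - g =
      (a1%:P - 'X) * (p * (a1%:P - 'X) * B ^+ 2 - (a2%:P - 'X)) by rewrite /g; ring.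
  exact: dvdp_mull.
have d12 : a1 - a2 != 0 by rewrite subr_eq0.
(* The interpolation of s1 at a1 and s2 at a2 is a square root of f modulo g. *)
pose w := (s1 / (a1 - a2)) *: ('X - a2%:P) + (s2 / (a2 - a1)) *: ('X - a1%:P).
have w1 : w.[a1] = s1 by rewrite /w !(horner_ringE, hornerZ) subrr mulr0 addr0 divfK.
have w2 : w.[a2] = s2.
  by rewrite /w !(horner_ringE, hornerZ) subrr mulr0 add0r divfK // subr_eq0 eq_sym.
have dvd a : f.[a] = w.[a] ^+ 2 -> (a%:P - 'X) %| f - w ^+ 2.
  by move=> e; rewrite -(opprB 'X) dvdpNl dvdp_XsubCl rootE hornerD hornerN horner_exp e subrr.
apply: (@unit_square_to_quot _ _ _ w) => //.
  by rewrite coprimepMl ![coprimep _ w]coprimep_sym !coprimep_subX w1 w2 s10.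
by rewrite Gauss_dvdp // !dvd ?w1 ?w2.
Qed.

End PAC.

(** * The quadratic character and residue fields *)

Lemma expf_card1 (F : finFieldType) (x : F) : x != 0 -> x ^+ #|F|.-1 = 1.
Proof.
move=> x0; apply: (mulfI x0); rewrite -exprS mulr1 prednK ?expf_card //.
exact: ltnW (finNzRing_gt1 F).
Qed.

Section QuadraticCharacter.
Variable E : finFieldType.
Hypothesis E2 : 2%:R != 0 :> E.
Local Notation q := #|E|.

Lemma pchar_nat_card : [pchar E].-nat q.
Proof.
have [p pr_p pE] := finPcharP E.
have [n qE] : exists n, q = (p ^ n)%N.
  by exists (logn p #|pPrimeCharType pE|); apply: card_pprimeChar.
by rewrite qE pnatX (eq_pnat _ (pcharf_eq pE)) pnat_id.
Qed.

Lemma card_odd : odd q.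
Proof.
have [p pr_p pE] := finPcharP E.
have [n ->] : exists n, q = (p ^ n)%N.
  by exists (logn p #|pPrimeCharType pE|); apply: card_pprimeChar.
rewrite oddX; apply/orP; right; have [p2|//] := even_prime pr_p.
by have := E2; rewrite -p2 (pcharf0 pE) eqxx.
Qed.

Definition half_card := q.-1./2.

Lemma half_cardE : (half_card * 2)%N = q.-1.
Proof.
have := odd_double_half q; rewrite card_odd => e.
by rewrite /half_card -e /= doubleK muln2.
Qed.

Lemma expf_half (x : E) : x != 0 -> x ^+ half_card = 1 \/ x ^+ half_card = -1.
Proof.
move=> x0; have : (x ^+ half_card) ^+ 2 == 1 by rewrite -exprM half_cardE expf_card1.
by rewrite sqrf_eq1 => /orP[] /eqP; [left|right].
Qed.

Definition quad_char (x : E) : int :=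
  if x == 0 then 0 else if x ^+ half_card == 1 then 1 else -1.

Lemma oppr1_neq1 : (-1 == 1 :> E) = false.
Proof. by apply: contraNF E2 => /eqP e; rewrite mulr2n -[X in X + _]e addNr. Qed.

Lemma quad_char1 : quad_char 1 = 1. Proof. by rewrite /quad_char oner_eq0 expr1n eqxx. Qed.

Lemma quad_charM x y : quad_char (x * y) = quad_char x * quad_char y.
Proof.
rewrite /quad_char mulf_eq0; have [_|x0] := eqVneq x 0; first by rewrite mul0r.
have [_|y0] := eqVneq y 0; first by rewrite mulr0.
rewrite exprMn /=.
by case: (expf_half x0) => ->; case: (expf_half y0) => ->;
   rewrite ?mul1r ?mulr1 ?mulrNN ?mulr1 ?eqxx ?oppr1_neq1.
Qed.

Lemma quad_charX x n : quad_char (x ^+ n) = quad_char x ^+ n.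
Proof. by elim: n => [|n IH]; rewrite ?expr0 ?quad_char1 // !exprS quad_charM IH. Qed.

Lemma quad_char_neq0 x : x != 0 -> quad_char x = 1 \/ quad_char x = -1.
Proof. by rewrite /quad_char => /negbTE->; case: ifP; [left|right]. Qed.

Lemma quad_char_sqr x : x != 0 -> quad_char x * quad_char x = 1.
Proof. by case/quad_char_neq0 => ->; rewrite ?mulr1 ?mulrNN ?mulr1. Qed.

Lemma quad_char_square x : x != 0 -> quad_char (x ^+ 2) = 1.
Proof. by move=> x0; rewrite expr2 quad_charM quad_char_sqr. Qed.

Lemma quad_char_nonsquare x : x ^+ half_card != 1 -> x != 0 -> quad_char x = -1.
Proof. by rewrite /quad_char => /negbTE-> /negbTE->. Qed.

Section ResidueField.
Variable p : {poly E}.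
Hypothesis p_irr : irreducible_poly p.
Hypothesis p_mon : p \is monic.
Let d := (size p).-1.

Lemma residue_field : exists (K : finFieldType) (s : {rmorphism {poly E} -> K}),
  [/\ forall x, exists h, s h = x, forall h, (s h == 0) = (p %| h) & #|K| = (q ^ d)%N].
Proof.
pose hI : monic_irreducible_poly p := (p_irr, p_mon).
exists {poly %/ p with hI}, (in_qpoly p); split; last by rewrite card_qfpoly.
- move=> x; exists (val x); apply: val_inj => /=.
  by rewrite Pdiv.Ring.rmodp_small // size_mk_monic.
move=> h; rewrite -val_eqE /= mk_monicE //.
by rewrite /dvdp Pdiv.IdomainMonic.modpE.
Qed.

Lemma expf_cardX (c : E) i : c ^+ (q ^ i) = c.
Proof. by elim: i => [|i IH]; rewrite ?expr1 // expnS exprM expf_card. Qed.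

Section Embedded.
Variables (K : finFieldType) (s : {rmorphism {poly E} -> K}).
Hypothesis s_surj : forall x, exists h, s h = x.
Hypothesis s_ker : forall h, (s h == 0) = (p %| h).
Hypothesis cardK : #|K| = (q ^ d)%N.
Let e : {rmorphism E -> K} := s \o polyC.
Let eta := s 'X.

Lemma residueE h : (map_poly e h).[eta] = s h.
Proof.
elim/poly_ind: h => [|h c IH]; first by rewrite !rmorph0 horner0.
by rewrite !rmorphD !rmorphM /= map_polyX map_polyC !horner_ringE IH.
Qed.

Lemma frobD (x y : K) i : (x + y) ^+ (q ^ i) = x ^+ (q ^ i) + y ^+ (q ^ i).
Proof.
apply: exprDn_pchar; rewrite (eq_pnat _ (fmorph_pchar e)).
by rewrite pnatX pchar_nat_card.
Qed.

Lemma frob_inj i : injective (fun x : K => x ^+ (q ^ i)).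
Proof.
move=> x y /= xy; have := frobD (x - y) y i; rewrite subrK xy => /(canLR (addrK _)).
rewrite subrr => /esym/eqP; rewrite expf_eq0 subr_eq0 => /andP[_ /eqP]; exact.
Qed.

Lemma horner_frob h x i : (map_poly e h).[x ^+ (q ^ i)] = (map_poly e h).[x] ^+ (q ^ i).
Proof.
have qi0 : (q ^ i != 0)%N by rewrite -lt0n expn_gt0 ltnW ?finNzRing_gt1.
elim/poly_ind: h => [|h c IH]; first by rewrite rmorph0 !horner0 expr0n (negbTE qi0).
have ec : e c ^+ (q ^ i) = e c by rewrite -rmorphXn expf_cardX.
by rewrite !rmorphD !rmorphM /= map_polyX map_polyC !horner_ringE frobD exprMn IH ec.
Qed.

Definition conjugates := [seq eta ^+ (q ^ i) | i <- iota 0 d].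

(** If the class eta of X were fixed by the i-th power of Frobenius with 0 < i <
    d, then so would be all q^d elements of K, which are too many roots for
    X^(q^i) - X. *)
Lemma conjugates_uniq : uniq conjugates.
Proof.
rewrite map_inj_in_uniq ?iota_uniq // => i j; rewrite !mem_iota /= !add0n => id jd.
wlog ij : i j id jd / (i <= j)%N.
  by move=> W; case: (leqP i j) => [/W|/ltnW/W h1 h2]; [exact | apply/esym/h1].
move=> eij; apply/eqP; rewrite eqn_leq ij leqNgt; apply/negP => ltij.
have {}eij : eta = eta ^+ (q ^ (j - i)).
  by apply: (@frob_inj i); rewrite /= -exprM -expnD subnK // eij.
have fixK (x : K) : x ^+ (q ^ (j - i)) = x.
  by have [h <-] := s_surj x; rewrite -residueE -horner_frob -eij.
have q1 : (1 < q)%N by apply: finNzRing_gt1.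
have k0 : (1 < q ^ (j - i))%N by rewrite -(expn0 q) ltn_exp2l // subn_gt0.
pose P : {poly K} := 'X^(q ^ (j - i)) - 'X.
have szP : size P = (q ^ (j - i)).+1.
  by rewrite size_polyDl size_polyXn // size_polyN size_polyX.
have := @max_poly_roots _ P (enum K); rewrite enum_uniq -cardE cardK szP ltnS leq_exp2l //.
rewrite -size_poly_eq0 szP => /(_ isT) le; have := leq_ltn_trans _ jd.
suff : (d <= j - i)%N by lia.
apply: le => //; apply/allP => x _.
by rewrite /root !hornerE fixK subrr.
Qed.

(** The conjugates of eta under Frobenius are d distinct roots of p. *)
Lemma conjugates_split : map_poly e p = \prod_(x <- conjugates) ('X - x%:P).
Proof.
rewrite [LHS](@all_roots_prod_XsubC _ _ conjugates).
- by rewrite lead_coef_map (monicP p_mon) rmorph1 scale1r.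
- by rewrite size_map_poly size_map size_iota prednK // size_poly_gt0 irredp_neq0.
- apply/allP => x /mapP[i _ ->]; rewrite /root horner_frob residueE.
  have /eqP -> : s p == 0 by rewrite s_ker.
  by rewrite expr0n -leqn0 leqNgt expn_gt0 ltnW ?finNzRing_gt1.
by rewrite uniq_rootsE conjugates_uniq.
Qed.

(** The product of the conjugates h(eta)^(q^i). *)
Lemma normp_residue h : e (normp p h) = s h ^+ (\sum_(i < d) q ^ i).
Proof.
rewrite (@quot_norm_poly _ _ _ e conjugates) ?irredp_neq0 //; last first.
  by rewrite (monicP p_mon) rmorph1 scale1r conjugates_split.
rewrite big_map -(big_mkord xpredT (fun i => q ^ i)%N) expr_sum /index_iota subn0.
by apply: eq_bigr => i _; rewrite horner_frob residueE.
Qed.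

(** z is a generator of the multiplicative group of K, of order q^d - 1. Its norm
    is its power of exponent (q^d - 1)/(q - 1), so chi of its norm is z^((q^d -
    1)/2), which is not 1. *)
Lemma primitive_residue : exists z, [/\ ~~ (p %| z), quad_char (normp p z) = -1
  & forall h, ~~ (p %| h) -> exists j, p %| h - z ^+ j].
Proof.
have K1 : (0 < #|K|.-1)%N by rewrite -subn1 subn_gt0 finNzRing_gt1.
have /hasP[zeta _ zetaP] : has #|K|.-1.-primitive_root [seq x <- enum K | x != 0].
  apply: has_prim_root => //; last 2 first.
  - by rewrite filter_uniq // enum_uniq.
  - have := count_predC (pred1 (0 : K)) (enum K).
    by rewrite count_uniq_mem ?enum_uniq // mem_enum -cardE size_filter => <-.
  apply/allP => x; rewrite mem_filter => /andP[x0 _]; apply/unity_rootP.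
  exact: expf_card1.
have [z zE] := s_surj zeta.
have zeta0 : zeta != 0.
  apply/eqP => z0; have := prim_expr_order zetaP.
  by rewrite z0 expr0n gtn_eqF // => /eqP; rewrite eq_sym oner_eq0.
have pz : ~~ (p %| z) by rewrite -s_ker zE.
exists z; split=> // [|h]; last first.
  rewrite -s_ker => sh0; have [j hj] := prim_rootP zetaP (expf_card1 sh0).
  by exists j; rewrite -s_ker rmorphB rmorphXn /= zE hj subrr.
apply: quad_char_nonsquare; last first.
  by rewrite -(fmorph_eq0 e) normp_residue zE expf_neq0.
rewrite -(inj_eq (fmorph_inj e)) rmorphXn rmorph1 normp_residue zE -exprM.
rewrite -(prim_order_dvd zetaP) cardK.
have QE : ((\sum_(i < d) q ^ i) * half_card * 2 = (q ^ d).-1)%N.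
  by rewrite -mulnA half_cardE predn_exp mulnC.
rewrite -QE; set Q := (_ * half_card)%N.
have Q0 : (0 < Q)%N by have := K1; rewrite cardK -QE -/Q muln_gt0 andbT.
by apply/negP => /(dvdn_leq Q0); rewrite leqNgt muln2 -addnn -{1}[Q]addn0 ltn_add2l Q0.
Qed.

End Embedded.

(** Modulo p, h is a power z^j of a generator, chi(N(h)) = (-1)^j, and j is even. *)
Lemma residue_square h : coprimep p h -> quad_char (normp p h) = 1 ->
  exists2 w, coprimep p w & p %| h - w ^+ 2.
Proof.
have [K [s [s1 s2 s3]]] := residue_field.
have [z [pz zN zgen]] := primitive_residue s1 s2 s3.
have cop w : ~~ (p %| w) -> coprimep p w by rewrite irreducible_poly_coprime.
rewrite irreducible_poly_coprime // => /zgen[j hj].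
rewrite (normp_eq (irredp_neq0 p_irr) hj).
have -> : normp p (z ^+ j) = normp p z ^+ j.
  elim: j {hj} => [|j IH]; first by rewrite !expr0 normp1 // irredp_neq0.
  by rewrite !exprS normpM IH.
rewrite quad_charX zN -signr_odd; case oddj: (odd j) => // _.
exists (z ^+ j./2); first by apply: coprimep_expr; apply: cop.
by rewrite -exprM muln2 -[X in z ^+ X](_ : j = _) // -[LHS]odd_double_half oddj.
Qed.

Lemma nonresidue_exists : exists2 z, coprimep p z & quad_char (normp p z) = -1.
Proof.
have [K [s [s1 s2 s3]]] := residue_field.
have [z [pz zN _]] := primitive_residue s1 s2 s3.
by exists z; rewrite // irreducible_poly_coprime.
Qed.

End ResidueField.
End QuadraticCharacter.

(** * The reciprocity law *)

Section Reciprocity.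
Variable E : fieldType.
Implicit Types f g h : {poly E}.

Lemma split_exists2 f g : f != 0 -> g != 0 ->
  exists (K : fieldType) (iota : {rmorphism E -> K}) (rs ss : seq K),
    map_poly iota f = iota (lead_coef f) *: \prod_(r <- rs) ('X - r%:P) /\
    map_poly iota g = iota (lead_coef g) *: \prod_(r <- ss) ('X - r%:P).
Proof.
move=> f0 g0; have [K [i [rs Df]]] := split_exists f0.
have [|L [j [ss Dg]]] := split_exists (_ : map_poly i g != 0); first by rewrite map_poly_eq0.
exists L, (j \o i), (map j rs), ss; split.
  rewrite map_poly_comp Df map_polyZ rmorph_prod big_map; congr (_ *: _).
  by apply: eq_bigr => r _; rewrite /= map_polyXsubC.
by rewrite map_poly_comp Dg lead_coef_map.
Qed.

Lemma normp_mul_mod f g h : f != 0 -> g != 0 ->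
  normp (f * g) h = normp f h * normp g h.
Proof.
move=> f0 g0; have [K [i [rs [ss [Df Dg]]]]] := split_exists2 f0 g0.
have fg0 : f * g != 0 by rewrite mulf_neq0.
apply: (fmorph_inj i); rewrite rmorphM.
rewrite (quot_norm_poly _ f0 Df) (quot_norm_poly _ g0 Dg).
rewrite (@quot_norm_poly _ _ _ i (rs ++ ss)) ?big_cat //.
by rewrite rmorphM /= Df Dg lead_coefM rmorphM -scalerAl -scalerAr scalerA.
Qed.

(** Both sides are products over pairs of roots: of s - r for the roots s of g and
    r of f on the left, and of r - s on the right. *)
Lemma normp_reciprocity f g : f != 0 -> g \is monic ->
  normp g f = ((-1) ^+ (size f).-1 * lead_coef f) ^+ (size g).-1 * normp f g.
Proof.
move=> f0 gm; have g0 := monic_neq0 gm.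
have [K [i [rs [ss [Df Dg]]]]] := split_exists2 f0 g0.
have szrs : size rs = (size f).-1.
  have := congr1 (fun p : {poly K} => (size p).-1) Df.
  by rewrite size_scale ?fmorph_eq0 ?lead_coef_eq0 // size_map_poly size_prod_XsubC.
have szss : size ss = (size g).-1.
  have := congr1 (fun p : {poly K} => (size p).-1) Dg.
  by rewrite size_scale ?fmorph_eq0 ?lead_coef_eq0 // size_map_poly size_prod_XsubC.
apply: (fmorph_inj i); rewrite rmorphM rmorphXn rmorphM rmorphXn rmorphN1.
rewrite (quot_norm_poly _ f0 Df) (quot_norm_poly _ g0 Dg) Df Dg.
rewrite (monicP gm) rmorph1 scale1r -szrs -szss.
have -> : \prod_(r <- rs) (\prod_(r0 <- ss) ('X - r0%:P)).[r] =
    \prod_(s <- ss) \prod_(r <- rs) (r - s).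
  rewrite exchange_big /=; apply: eq_bigr => r _; rewrite horner_prod.
  by apply: eq_bigr => s _; rewrite !horner_ringE.
rewrite -[in RHS](count_predT ss) -iter_mulr_1 -big_const_seq -big_split.
apply: eq_bigr => s _; rewrite /= hornerZ [RHS]mulrAC mulrC; congr (_ * _).
rewrite horner_prod -(count_predT rs) -iter_mulr_1 -big_const_seq -big_split.
by apply: eq_bigr => r _; rewrite /= !horner_ringE mulN1r opprB.
Qed.

End Reciprocity.

(** * Monic polynomials of a given degree *)

Section MonicPolys.
Variable E : finFieldType.
Local Notation q := #|E|.

Definition monics (j : nat) : seq {poly E} :=
  [seq 'X^j + val p | p <- enum {poly_j E}].

Lemma mem_monics j p : (p \in monics j) = (p \is monic) && (size p == j.+1).
Proof.
apply/mapP/andP => [[r _ ->]|[pm /eqP szp]].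
  have ltr : (size (val r) < size ('X^j : {poly E}))%N.
    by rewrite size_polyXn ltnS size_npoly.
  by rewrite monicE lead_coefDl // lead_coefXn size_polyDl // size_polyXn.
have szr : (size (p - 'X^j : {poly E})%R <= j)%N.
  apply/leq_sizeP => i; rewrite leq_eqVlt coefB coefXn => /orP[/eqP <-|lti].
    by rewrite eqxx; move/monicP: pm; rewrite /lead_coef szp => ->; rewrite subrr.
  by rewrite nth_default ?szp // gtn_eqF ?subrr.
exists (npolyp j (p - 'X^j)); first by rewrite mem_enum.
by rewrite [val _]npolypK // addrC subrK.
Qed.

Lemma monics_uniq j : uniq (monics j).
Proof.
rewrite map_inj_uniq ?enum_uniq // => r s /addrI; exact: val_inj.
Qed.

Lemma size_monics j : size (monics j) = (q ^ j)%N.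
Proof. by rewrite size_map -cardE card_npoly. Qed.

(** Each class has a representative of degree less than N, to which the multiples
    G * t with G made monic and t monic of degree j - N are added. *)
Lemma count_monics_mod (G rho : {poly E}) N j : size G = N.+1 -> (N <= j)%N ->
  count (fun e => G %| e - rho) (monics j) = (q ^ (j - N))%N.
Proof.
move=> szG leNj; have G0 : G != 0 by rewrite -size_poly_eq0 szG.
have lG : lead_coef G != 0 by rewrite lead_coef_eq0.
pose Gm := (lead_coef G)^-1 *: G.
have Gmm : Gm \is monic by rewrite monicE lead_coefZ mulVf.
have szGm : size Gm = N.+1 by rewrite size_scale // invr_eq0.
have szr : (size (rho %% G)%R <= N)%N by rewrite -ltnS -szG ltn_modpN0.
rewrite -size_filter -size_monics -[RHS](size_map (fun t => Gm * t + rho %% G)).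
apply/perm_size/uniq_perm.
- by rewrite filter_uniq // monics_uniq.
- rewrite map_inj_uniq ?monics_uniq // => s t /addIr; apply: mulfI.
  exact: monic_neq0.
move=> e; rewrite mem_filter mem_monics; apply/idP/mapP => [/and3P[]|[t]].
  move=> eG em /eqP sze.
  have : Gm %| e - rho %% G.
    rewrite /Gm dvdpZl ?invr_eq0 // -(subrK rho e) -addrA dvdp_add //.
    by rewrite {1}(divp_eq rho G) addrK dvdp_mull.
  case/dvdpP=> t et; have lt_re : (size (- (rho %% G))%R < size e)%N.
    by rewrite size_polyN sze ltnS (leq_trans szr).
  have tm : t \is monic.
    by rewrite -(monicMr _ Gmm) -et monicE lead_coefDl.
  exists t; last by rewrite mulrC -et subrK.
  rewrite mem_monics tm /=; have := size_polyDl lt_re.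
  rewrite et size_monicM // ?monic_neq0 // szGm sze => h; apply/eqP; move: h.
  by move: (size t) => st; lia.
rewrite mem_monics => /andP[tm /eqP szt] ->.
have szGt : size (Gm * t) = j.+1.
  by rewrite size_monicM ?monic_neq0 // szGm szt; lia.
have ltr : (size (rho %% G)%R < size (Gm * t)%R)%N by rewrite szGt ltnS (leq_trans szr).
rewrite monicE lead_coefDl // size_polyDl // szGt -monicE monicMl // tm eqxx !andbT.
have -> : Gm * t + rho %% G - rho = Gm * t - rho %/ G * G.
  by rewrite {2}(divp_eq rho G); ring.
rewrite /Gm -scalerAl; by rewrite dvdp_sub ?dvdp_mull // dvdpZr ?invr_eq0 // dvdp_mulr.
Qed.

End MonicPolys.

Lemma ltn_predD (x y : nat) : (1 < x -> 0 < y -> y < (x + y).-1)%N.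
Proof. by lia. Qed.

Lemma poly_crt (E : fieldType) (f g a b : {poly E}) : coprimep f g ->
  exists r, f %| r - a /\ g %| r - b.
Proof.
move=> /Bezout_eq1_coprimepP[[u v] /= e].
exists (a * (v * g) + b * (u * f)); split.
  have -> : a * (v * g) + b * (u * f) - a = (b - a) * u * f.
    have -> : v * g = 1 - u * f by rewrite -e; ring.
    by ring.
  exact: dvdp_mull.
have -> : a * (v * g) + b * (u * f) - b = (a - b) * v * g.
  have -> : u * f = 1 - v * g by rewrite -e; ring.
  by ring.
exact: dvdp_mull.
Qed.

Lemma monic_irreducible_factor (F : fieldType) (p : {poly F}) :
  (1 < size p)%N -> exists r, [/\ irreducible_poly r, r \is monic & r %| p].
Proof.
move=> /irreducible_factor[r irr rp].
have lr : (lead_coef r)^-1 != 0 by rewrite invr_eq0 lead_coef_eq0 irredp_neq0.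
exists ((lead_coef r)^-1 *: r); split.
- case: irr => sz1 irr; split; first by rewrite size_scale.
  by move=> t szt; rewrite dvdpZr // => /(irr _ szt) h;
    rewrite (eqp_trans h) // eqp_sym eqp_scale.
- by rewrite monicE lead_coefZ mulVf // -(invr_eq0 (lead_coef r)).
by rewrite dvdpZl.
Qed.

Lemma monic_size1 (F : fieldType) (p : {poly F}) :
  p \is monic -> (size p <= 1)%N -> p = 1.
Proof.
move=> pm szp; have := monicP pm; rewrite (size1_polyC szp) lead_coefC => ->.
by [].
Qed.

(** * Jacobi symbols and divisor sums *)

Section Symbols.
Variable E : finFieldType.
Hypothesis E2 : 2%:R != 0 :> E.
Local Notation q := #|E|.
Local Notation quad_char := (@quad_char E).
Variable f : {poly E}.
Hypothesis f_gt1 : (1 < size f)%N.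
Hypothesis f_sf : square_free f.
Let n := (size f).-1.

Let f0 : f != 0. Proof. by rewrite -size_poly_gt0 ltnW. Qed.

(** The Jacobi symbols (f/d) and (h/f), defined by the quadratic character of a
    norm instead of a factorisation of the modulus. *)
Definition symbol_f_mod (d : {poly E}) : int := if coprimep f d then quad_char (normp d f) else 0.
Definition symbol_mod_f (h : {poly E}) : int := if coprimep f h then quad_char (normp f h) else 0.
(** The factor for each degree of d in the reciprocity law. *)
Definition recip_sign : int := quad_char ((-1) ^+ n * lead_coef f).

Lemma recip_sign2 : recip_sign * recip_sign = 1.
Proof.
apply: quad_char_sqr; rewrite mulf_neq0 ?lead_coef_eq0 // expf_neq0 //.
by rewrite oppr_eq0 oner_neq0.
Qed.

Lemma symbol_reciprocity d : d \is monic ->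
  symbol_f_mod d = recip_sign ^+ (size d).-1 * symbol_mod_f d.
Proof.
move=> dm; rewrite /symbol_f_mod /symbol_mod_f; case: ifP => _; last by rewrite mulr0.
by rewrite normp_reciprocity // quad_charM // quad_charX.
Qed.

Lemma symbol_f_modM d d' : d != 0 -> d' != 0 ->
  symbol_f_mod (d * d') = symbol_f_mod d * symbol_f_mod d'.
Proof.
move=> d0 d'0; rewrite /symbol_f_mod coprimepMr.
case: (coprimep f d) => /=; last by rewrite mul0r.
case: (coprimep f d') => /=; last by rewrite mulr0.
by rewrite normp_mul_mod // quad_charM.
Qed.

Lemma symbol_mod_fM h h' : symbol_mod_f (h * h') = symbol_mod_f h * symbol_mod_f h'.
Proof.
rewrite /symbol_mod_f coprimepMr.
case: (coprimep f h) => /=; last by rewrite mul0r.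
case: (coprimep f h') => /=; last by rewrite mulr0.
by rewrite normpM quad_charM.
Qed.

Lemma symbol_mod_f_mod h h' : f %| h - h' -> symbol_mod_f h = symbol_mod_f h'.
Proof.
move=> hh'; rewrite /symbol_mod_f (normp_eq f0 hh').
suff -> : coprimep f h = coprimep f h' by [].
apply/idP/idP; apply: coprimep_sub_dvd => //.
by rewrite -opprB dvdpNr.
Qed.

Lemma symbol_f_mod_values d : d != 0 -> coprimep f d -> symbol_f_mod d = 1 \/ symbol_f_mod d = -1.
Proof.
move=> d0 fd; rewrite /symbol_f_mod fd; apply: quad_char_neq0; apply: normp_neq0 => //.
by rewrite coprimep_sym.
Qed.

Lemma symbol_f_mod_sqr d : d != 0 -> coprimep f d -> symbol_f_mod d * symbol_f_mod d = 1.
Proof. by move=> d0 /(symbol_f_mod_values d0)[] ->; rewrite ?mulr1 ?mulrNN ?mulr1. Qed.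

Lemma symbol_f_mod1 : symbol_f_mod 1 = 1.
Proof.
rewrite symbol_reciprocity ?monic1 // size_poly1 expr0 mul1r /symbol_mod_f coprimep1.
by rewrite normp1 // quad_char1.
Qed.

(** An irreducible factor p divides f only once, as f is square-free: h is a
    nonresidue modulo p and 1 modulo f / p. *)
Lemma symbol_mod_f_nontrivial : exists2 h, coprimep f h & symbol_mod_f h = -1.
Proof.
have [p [irr pm /dvdpP[f' fE]]] := monic_irreducible_factor f_gt1.
have f'0 : f' != 0 by apply: contraNneq f0 => e; rewrite fE e mul0r.
have p0 := irredp_neq0 irr.
have copp : coprimep p f'.
  rewrite irreducible_poly_coprime //; apply/negP => /dvdpP[k kE].
  have /f_sf/is_unit_poly sz : f = p ^+ 2 * k by rewrite fE kE; ring.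
  by case: irr; rewrite sz.
have [z pz zN] := nonresidue_exists E2 irr pm.
have [h [hz h1]] := poly_crt z 1 copp.
have hp : coprimep p h by apply: coprimep_sub_dvd pz; rewrite -opprB dvdpNr.
have hf' : coprimep f' h.
  by apply: (@coprimep_sub_dvd _ f' 1); rewrite ?coprimep1 // -opprB dvdpNr.
have fh : coprimep f h by rewrite fE coprimepMl hf' hp.
exists h; rewrite // /symbol_mod_f fh fE mulrC normp_mul_mod // quad_charM //.
by rewrite (normp_eq p0 hz) (normp_eq f'0 h1) normp1 // quad_char1 mulr1.
Qed.

Definition symbol_sum i : int := \sum_(d <- monics E i) symbol_f_mod d.

(** By reciprocity the sum is, up to sign, the sum of (d/f) over d. As i >= deg f,
    the monic d of degree i are evenly distributed among the residue classes
    modulo f, and the nontrivial character sums to 0. *)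
Lemma symbol_sum_eq0 i : (n <= i)%N -> symbol_sum i = 0.
Proof.
move=> leni; rewrite /symbol_sum.
have -> : \sum_(d <- monics E i) symbol_f_mod d
  = recip_sign ^+ i * \sum_(d <- monics E i) symbol_mod_f d.
  rewrite mulr_sumr big_seq [RHS]big_seq; apply: eq_bigr => d.
  by rewrite mem_monics => /andP[dm /eqP szd]; rewrite symbol_reciprocity // szd.
have [h fh psih] := symbol_mod_f_nontrivial.
(* A permutation of the monic polynomials of degree i that multiplies the class
   modulo f by h. *)
pose tw d := d - d %% f + (h * d) %% f.
have tw_mod d : f %| tw d - h * d.
  have -> : tw d - h * d = d %/ f * f - (h * d) %/ f * f.
    by rewrite /tw {1}(divp_eq d f) [X in _ - X](divp_eq (h * d) f); ring.
  by rewrite dvdp_sub // dvdp_mull.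
have twP : perm_eq (map tw (monics E i)) (monics E i).
  have unitw : uniq (map tw (monics E i)).
    rewrite map_inj_in_uniq ?monics_uniq // => d d' _ _ twE.
    have : f %| h * (d - d').
      have -> : h * (d - d') = (tw d' - h * d') - (tw d - h * d) by rewrite twE; ring.
      by rewrite dvdp_sub.
    rewrite Gauss_dvdpr // => fdd'; have modE : d %% f = d' %% f.
      apply/eqP; rewrite -subr_eq0 -modNp -modpD; exact: fdd'.
    move: twE; rewrite /tw modE (_ : (h * d) %% f = (h * d') %% f); last first.
      by rewrite -modp_mul modE modp_mul.
    by move/addIr/addIr.
  have sub : {subset map tw (monics E i) <= monics E i}.
    move=> _ /mapP[d + ->]; rewrite !mem_monics => /andP[dm /eqP szd].
    have lt_r g : (size (g %% f)%R <= i)%N.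
      by rewrite (leq_trans _ leni) // -ltnS /n prednK ?size_poly_gt0 // ltn_modpN0.
    have lt : (size ((h * d) %% f - d %% f)%R < size d)%N.
      by rewrite szd ltnS (leq_trans (size_polyD _ _)) // geq_max size_polyN !lt_r.
    have -> : tw d = d + ((h * d) %% f - d %% f) by rewrite /tw; ring.
    by rewrite monicE lead_coefDl // size_polyDl // szd eqxx andbT.
  have [|_ eqi] := uniq_min_size unitw sub; first by rewrite (size_map tw).
  by apply: uniq_perm => //; apply: monics_uniq.
have S : \sum_(d <- monics E i) symbol_mod_f d = - \sum_(d <- monics E i) symbol_mod_f d.
  rewrite -{1}(perm_big _ twP) big_map -sumrN; apply: eq_bigr => d _.
  by rewrite (symbol_mod_f_mod (tw_mod d)) symbol_mod_fM psih mulN1r.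
have -> : \sum_(d <- monics E i) symbol_mod_f d = 0 by move: S; lia.
by rewrite mulr0.
Qed.

Definition divisor_sum i (m : {poly E}) : int := \sum_(d <- monics E i | d %| m) symbol_f_mod d.

(** The substitution of m / d for d; note that (f/d) is its own inverse. *)
Lemma divisor_sum_sym k i m : m \in monics E k -> coprimep f m -> (i <= k)%N ->
  divisor_sum (k - i) m = symbol_f_mod m * divisor_sum i m.
Proof.
rewrite mem_monics => /andP[mm /eqP szm] fm ik; have m0 := monic_neq0 mm.
rewrite /divisor_sum -big_filter -[in RHS]big_filter.
have cof j d : (j <= k)%N -> d \in [seq d <- monics E j | d %| m] ->
    m %/ d \in [seq d <- monics E (k - j) | d %| m] /\ m %/ d * d = m.
  move=> jk; rewrite !mem_filter !mem_monics => /and3P[dm dmon /eqP szd].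
  have e := divpK dm; split=> //; apply/and3P; split.
  - by rewrite -{2}e dvdp_mulr.
  - by rewrite -(monicMr _ dmon) e.
  rewrite size_divp ?monic_neq0 // szm szd; apply/eqP; lia.
have P : perm_eq (map (fun d => m %/ d) [seq d <- monics E i | d %| m])
    [seq d <- monics E (k - i) | d %| m].
  apply: uniq_perm; last 2 first.
  - by rewrite filter_uniq // monics_uniq.
  - move=> d; apply/mapP/idP => [[d' /(cof _ _ ik)[]] d'2 _ -> //|dF].
    have [dF' e] := cof _ _ (leq_subr i k) dF; rewrite subKn // in dF'.
    exists (m %/ d) => //; have [_ e'] := cof _ _ ik dF'.
    have md0 : m %/ d != 0 by apply: contraNneq m0 => z; rewrite -e z mul0r.
    by apply: (mulIf md0); rewrite e' mulrC e.
  rewrite map_inj_in_uniq ?filter_uniq ?monics_uniq // => d d' dF d'F dd'.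
  have [_ e] := cof _ _ ik dF; have [_ e'] := cof _ _ ik d'F.
  have md0 : m %/ d != 0 by apply: contraNneq m0 => z; rewrite -e z mul0r.
  by apply: (mulfI md0); rewrite e dd' e'.
rewrite -(perm_big _ P) big_map mulr_sumr big_seq [RHS]big_seq.
apply: eq_bigr => d dF; have [_ e] := cof _ _ ik dF.
have d0 : d != 0 by apply: contraNneq m0 => z; rewrite -e z mulr0.
have md0 : m %/ d != 0 by apply: contraNneq m0 => z; rewrite -e z mul0r.
have fd : coprimep f d by move: fm; rewrite -e coprimepMr => /andP[].
by rewrite -[in RHS]e symbol_f_modM // -mulrA symbol_f_mod_sqr // mulr1.
Qed.

(** Exchange the sums. If d is coprime to f, then m = b modulo f and m = 0 modulo
    d is one congruence modulo f * d, with q^(k - i - n) solutions of degree k. *)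
Lemma sum_divisor_sum k i b : coprimep f b -> (i + n <= k)%N ->
  \sum_(m <- monics E k | f %| m - b) divisor_sum i m = (q ^ (k - i - n))%:Z * symbol_sum i.
Proof.
move=> fb le; rewrite /divisor_sum /symbol_sum mulr_sumr.
under eq_bigr => m _ do rewrite big_mkcond.
rewrite exchange_big /= big_seq [RHS]big_seq; apply: eq_bigr => d.
rewrite mem_monics => /andP[dm /eqP szd].
rewrite -big_mkcondr /=.
have [fd|nfd] := boolP (coprimep f d); last first.
  by rewrite /symbol_f_mod (negbTE nfd) mulr0 big1.
have [r [rb rd]] := poly_crt b 0 fd; rewrite subr0 in rd.
have dn0 : d != 0 := monic_neq0 dm.
rewrite big_const_seq iter_addr_0 -mulr_natl natz; congr ((Posz _) * _).
rewrite -subnDA -(@count_monics_mod E (f * d) r (i + n) k) //; last first.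
  by rewrite size_mul // szd /n; move: (size f) f_gt1 => sf; lia.
apply: eq_count => m; rewrite /= Gauss_dvdp //; congr (_ && _).
  apply/idP/idP => h.
    have -> : m - r = (m - b) - (r - b) by ring.
    by rewrite dvdp_sub.
  have -> : m - b = (m - r) + (r - b) by ring.
  by rewrite dvdp_add.
apply/idP/idP => h; first by rewrite dvdp_sub.
by rewrite -(subrK r m) dvdp_add.
Qed.

Definition total_weight k : int := \sum_(0 <= i < n) (q ^ (k - i - n))%:Z * symbol_sum i.

Definition all_divisor_sum (m : {poly E}) : int := \sum_(0 <= i < size m) divisor_sum i m.

(** The divisors of degree i < n contribute W_k = [total_weight k] by [sum_divisor_sum], those with n
    <= i <= k - n contribute 0 by [symbol_sum_eq0], and those of degree i > k - n
    are the m / d with d of degree less than n, which contribute (f/m) W_k, where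
    (f/m) = e^k (b/f) by reciprocity, with e = [recip_sign]. *)
Lemma sum_all_divisor_sum k b : coprimep f b -> (2 * n <= k)%N ->
  \sum_(m <- monics E k | f %| m - b) all_divisor_sum m
    = (1 + recip_sign ^+ k * symbol_mod_f b) * total_weight k.
Proof.
move=> fb le.
have -> : \sum_(m <- monics E k | f %| m - b) all_divisor_sum m =
   \sum_(0 <= i < k.+1) \sum_(m <- monics E k | f %| m - b) divisor_sum i m.
  rewrite exchange_big /= big_seq_cond [RHS]big_seq_cond; apply: eq_bigr => m.
  by rewrite mem_monics => /andP[/andP[_ /eqP szm] _]; rewrite /all_divisor_sum szm.
rewrite (big_cat_nat (n := n)) //=; last by lia.
rewrite (big_cat_nat (n := (k.+1 - n)%N) (m := n)) /=; [|by lia|by lia].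
have -> : \sum_(0 <= i < n) \sum_(m <- monics E k | f %| m - b) divisor_sum i m = total_weight k.
  by apply: eq_big_nat => i /andP[_ lti]; rewrite sum_divisor_sum //; lia.
have -> : \sum_(n <= i < k.+1 - n) \sum_(m <- monics E k | f %| m - b) divisor_sum i m = 0.
  rewrite big_nat big1 // => i /andP[lei lti].
  by rewrite sum_divisor_sum ?symbol_sum_eq0 ?mulr0 //; lia.
have -> : \sum_(k.+1 - n <= i < k.+1) \sum_(m <- monics E k | f %| m - b) divisor_sum i m =
    recip_sign ^+ k * symbol_mod_f b * total_weight k.
  rewrite -{1}[(k.+1 - n)%N]add0n big_addn subKn; last by lia.
  rewrite big_nat_rev /= add0n /total_weight mulr_sumr; apply: eq_big_nat => i /andP[_ lti].
  have -> : (n - i.+1 + (k.+1 - n) = k - i)%N by lia.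
  rewrite -(@sum_divisor_sum k i b) //; last by lia.
  rewrite mulr_sumr big_seq_cond [RHS]big_seq_cond; apply: eq_bigr => m /andP[mk fmb].
  have fm : coprimep f m by apply: coprimep_sub_dvd fb; rewrite -opprB dvdpNr.
  rewrite (divisor_sum_sym mk fm); last by lia.
  move: mk; rewrite mem_monics => /andP[mm /eqP szm].
  by rewrite symbol_reciprocity // szm (symbol_mod_f_mod fmb).
by ring.
Qed.

(** [total_weight k] depends on k only through a power of q, so positivity for one k suffices. *)
Lemma total_weightE k : (2 * n <= k)%N ->
  total_weight k = (q ^ (k.+1 - 2 * n))%:Z * \sum_(0 <= i < n) (q ^ (n.-1 - i))%:Z * symbol_sum i.
Proof.
move=> le; rewrite /total_weight mulr_sumr; apply: eq_big_nat => i /andP[_ lti].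
rewrite mulrA -PoszM -expnD; congr (Posz (q ^ _) * _); lia.
Qed.

Definition monic_divisors (m : {poly E}) :=
  [seq d <- flatten [seq monics E i | i <- iota 0 (size m)] | d %| m].

Lemma mem_monic_divisors m d : m != 0 -> (d \in monic_divisors m) = (d \is monic) && (d %| m).
Proof.
move=> m0; rewrite mem_filter andbC; case dm: (d %| m); rewrite ?andbF // !andbT.
apply/flatten_mapP/idP => [[i _]|dmon]; first by rewrite mem_monics => /andP[].
have szd : (0 < size d)%N by rewrite size_poly_gt0 monic_neq0.
exists (size d).-1; last by rewrite mem_monics dmon prednK /=.
by rewrite mem_iota add0n prednK // dvdp_leq.
Qed.

Lemma monic_divisors_uniq m : uniq (monic_divisors m).
Proof.
rewrite filter_uniq //; elim: (size m) 0%N => //= k IH a.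
rewrite cat_uniq monics_uniq IH andbT /=; apply/hasPn => d /flatten_mapP[i].
rewrite mem_iota !mem_monics => /andP[lti _] /andP[_ /eqP ->].
by rewrite eqSS gtn_eqF ?andbF.
Qed.

Lemma all_divisor_sumE m : all_divisor_sum m = \sum_(d <- monic_divisors m) symbol_f_mod d.
Proof.
rewrite /monic_divisors big_filter big_flatten big_map /all_divisor_sum /index_iota subn0.
by apply: eq_bigr => i _.
Qed.

Lemma all_divisor_sum1 : all_divisor_sum 1 = 1.
Proof.
rewrite all_divisor_sumE (perm_big [:: 1]) ?big_seq1 ?symbol_f_mod1 //.
apply: uniq_perm; rewrite ?monic_divisors_uniq // => d;
  rewrite mem_monic_divisors ?oner_neq0 // inE.
apply/andP/eqP => [[dm]|->]; last by rewrite monic1 dvdpp.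
by rewrite dvdp1 => /eqP sz1; apply: monic_size1; rewrite ?sz1.
Qed.

Section PrimePower.
Variables p m' : {poly E}.
Hypothesis p_irr : irreducible_poly p.
Hypothesis p_mon : p \is monic.
Hypothesis m'_mon : m' \is monic.
Hypothesis pm' : ~~ (p %| m').

Let p0 : p != 0 := monic_neq0 p_mon.

(** A monic divisor of p^(a+1) m' is either p times a divisor of p^a m' or a
    divisor of m'. *)
Lemma all_divisor_sum_prime_rec a : all_divisor_sum (p * (p ^+ a * m'))
  = symbol_f_mod p * all_divisor_sum (p ^+ a * m') + all_divisor_sum m'.
Proof.
set m := p ^+ a * m'.
have mm : m \is monic by rewrite monicMl ?monic_exp.
have [m0 m'0] := (monic_neq0 mm, monic_neq0 m'_mon).
have pm0 : p * m != 0 by rewrite mulf_neq0.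
rewrite !all_divisor_sumE (perm_big (map (fun d => p * d) (monic_divisors m) ++
  monic_divisors m')).
  rewrite big_cat big_map /= mulr_sumr; congr (_ + _).
  rewrite big_seq [RHS]big_seq; apply: eq_bigr => d.
  by rewrite mem_monic_divisors // => /andP[dm _]; rewrite symbol_f_modM // monic_neq0.
apply: uniq_perm; first exact: monic_divisors_uniq.
  rewrite cat_uniq monic_divisors_uniq map_inj_uniq ?monic_divisors_uniq ?andbT /=;
    last exact: mulfI.
  apply/hasPn => d; rewrite mem_monic_divisors // => /andP[_ dm']; apply/negP => /mapP[d' _ dE].
  by case/negP: pm'; apply: dvdp_trans dm'; rewrite dE dvdp_mulr.
move=> d; rewrite mem_monic_divisors // mem_cat mem_monic_divisors //;
  apply/andP/orP => [[dmon ddvd]|].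
  have [pd|npd] := boolP (p %| d).
    left; apply/mapP; exists (d %/ p); last by rewrite mulrC divpK.
    have e := divpK pd.
    rewrite mem_monic_divisors // -(monicMr _ p_mon) e dmon /=.
    by rewrite -(dvdp_mul2r _ _ p0) e mulrC.
  right; rewrite dmon /=; move: ddvd; rewrite /m mulrA -exprS Gauss_dvdpr //.
  by rewrite coprimep_sym; apply: coprimep_expl; rewrite irreducible_poly_coprime.
case=> [/mapP[d' +] ->|/andP[dmon dm']].
  by rewrite mem_monic_divisors // => /andP[d'm dm]; rewrite monicMl // d'm dvdp_mul2l.
by rewrite dmon; split=> //; rewrite /m mulrA dvdp_mull.
Qed.

Lemma all_divisor_sum_prime_power a : symbol_f_mod p = 1 \/ symbol_f_mod p = -1 ->
  all_divisor_sum (p ^+ a * m') =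
    (if symbol_f_mod p == 1 then a.+1%:Z else (~~ odd a)%:Z) * all_divisor_sum m'.
Proof.
move=> lp; elim: a => [|a IH].
  by rewrite expr0 !mul1r; case: ifP; rewrite mul1r.
rewrite exprS -mulrA all_divisor_sum_prime_rec IH.
case: lp => -> /=; first by rewrite mul1r -[X in _ + X]mul1r -mulrDl; congr (_ * _); lia.
by case: (odd a); rewrite /= ?mul0r ?mulr0 ?add0r ?mul1r // mulN1r addNr.
Qed.

End PrimePower.

Lemma prime_power_part (m : {poly E}) p : irreducible_poly p -> m != 0 ->
  exists a m', m = p ^+ a * m' /\ ~~ (p %| m').
Proof.
move=> irr; have [k] := ubnP (size m); elim: k m => // k IH m lt m0.
have [pm|npm] := boolP (p %| m); last by exists 0%N, m; rewrite expr0 mul1r.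
have e := divpK pm; have p0 := irredp_neq0 irr.
have mp0 : m %/ p != 0 by apply: contraNneq m0 => z; rewrite -e z mul0r.
have p1 : (1 < size p)%N by case: irr.
have [|a [m' [mE pm']]] := IH (m %/ p) _ mp0.
  rewrite size_divp //; move: lt p1 (size_poly_gt0 m); rewrite m0.
  by move: (size m) (size p) => x y; lia.
by exists a.+1, m'; split=> //; rewrite -e mE exprS; ring.
Qed.

Lemma monic_prime_split (m : {poly E}) : m \is monic -> (1 < size m)%N -> coprimep f m ->
  exists p a m', [/\ m = p ^+ a.+1 * m', irreducible_poly p, p \is monic, m' \is monic
    & ~~ (p %| m')] /\ [/\ coprimep f p, coprimep f m' & (size m' < size m)%N].
Proof.
move=> mm m1 fm; have [p [irr pm pdm]] := monic_irreducible_factor m1.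
have m0 := monic_neq0 mm.
have [[|a] [m' [mE pm']]] := prime_power_part irr m0.
  by case/negP: pm'; rewrite -[m']mul1r -[1](expr0 p) -mE.
have pa : p ^+ a.+1 \is monic by apply: monic_exp.
have m'm : m' \is monic by rewrite -(monicMl _ pa) -mE.
have fp : coprimep f p by move: fm; rewrite mE exprS -mulrA coprimepMr => /andP[].
have fm' : coprimep f m' by move: fm; rewrite mE coprimepMr => /andP[].
exists p, a, m'; split; split=> //.
have p1 : (1 < size p)%N by case: irr.
have := size_monicM pa (monic_neq0 m'm); rewrite -mE => ->.
have pos (g : {poly E}) : g \is monic -> (0 < size g)%N.
  by move=> gm; rewrite size_poly_gt0 monic_neq0.
apply: ltn_predD; last exact: pos.
have pa0 : p ^+ a \is monic by apply: monic_exp.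
rewrite exprS size_monicM ?monic_neq0 //.
by apply: leq_ltn_trans (ltn_predD p1 (pos _ pa0)); apply: pos.
Qed.

Lemma symbol_f_mod_residue p : irreducible_poly p -> p \is monic -> coprimep f p ->
  symbol_f_mod p = 1 ->
  exists2 w, coprimep p w & p %| f - w ^+ 2.
Proof.
move=> irr pm fp; rewrite /symbol_f_mod fp; apply: residue_square => //.
by rewrite coprimep_sym.
Qed.

(** A prime factor p with (f/p) = -1 makes r(m) = [all_divisor_sum m] vanish unless its
    exponent is even. So if r(m) is nonzero, let g be the product of the primes of odd
    exponent: f is a square modulo each of them, hence modulo g by the Chinese
    remainder theorem. *)
Lemma all_divisor_sum_structure m : m \is monic -> coprimep f m ->
  0 <= all_divisor_sum m /\ (all_divisor_sum m != 0 ->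
    exists g s w, [/\ m = g * s ^+ 2, g \is monic,
     coprimep g w & g %| f - w ^+ 2]).
Proof.
have [k] := ubnP (size m); elim: k m => // k IH m lt mm fm.
have [m1|m_gt1] := leqP (size m) 1.
  have -> : m = 1 by apply: monic_size1.
  rewrite all_divisor_sum1; split=> // _; exists 1, 1, 1.
  by split; rewrite ?expr1n ?mulr1 ?monic1 ?coprime1p ?dvd1p.
have [p [a [m' [[mE irr pm m'm pm'] [fp fm' ltm']]]]] := monic_prime_split mm m_gt1 fm.
have [r0 rs] := IH m' (leq_trans ltm' lt) m'm fm'.
have lp := symbol_f_mod_values (monic_neq0 pm) fp.
have rE := all_divisor_sum_prime_power irr pm m'm pm' a.+1 lp.
rewrite -mE in rE; split.
  by rewrite rE; apply: Num.Theory.mulr_ge0 => //; case: ifP.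
rewrite rE mulf_eq0 negb_or => /andP[ca /rs[g [s [w [m'E gm gw gfw]]]]].
have mE' h : odd a.+1 = h -> m = (if h then p * g else g) * (p ^+ (a.+1./2) * s) ^+ 2.
  move=> ha; rewrite mE m'E -[in LHS](odd_double_half a.+1) ha -muln2 exprD exprM.
  by case: h {ha}; rewrite ?expr1 ?expr0 exprMn; ring.
have [odd_a|even_a] := boolP (odd a.+1); last first.
  by exists g, (p ^+ (a.+1./2) * s), w; split=> //; exact: (mE' false (negbTE even_a)).
have lp1 : symbol_f_mod p = 1.
  by case: lp => // e; move: ca; rewrite e odd_a.
have [v pv pfv] := symbol_f_mod_residue irr pm fp lp1.
have pg : coprimep p g.
  rewrite irreducible_poly_coprime //; apply: contra pm' => pg.
  by rewrite m'E dvdp_mulr.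
have [z [zv zw]] := poly_crt v w pg.
exists (p * g), (p ^+ (a.+1./2) * s), z; split.
- exact: (mE' true).
- by rewrite monicMl.
- rewrite coprimepMl; apply/andP; split.
    by apply: coprimep_sub_dvd pv; rewrite -opprB dvdpNr.
  by apply: coprimep_sub_dvd gw; rewrite -opprB dvdpNr.
have sq (d x y : {poly E}) : d %| x - y -> d %| f - y ^+ 2 -> d %| f - x ^+ 2.
  move=> dxy dfy; have -> : f - x ^+ 2 = (f - y ^+ 2) - (x - y) * (x + y) by ring.
  by rewrite dvdp_sub // dvdp_mulr.
by rewrite Gauss_dvdp // (sq _ _ _ zv pfv) (sq _ _ _ zw gfw).
Qed.

Lemma all_divisor_sum_square_gt0 t : t \is monic -> coprimep f t -> 0 < all_divisor_sum (t ^+ 2).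
Proof.
have [k] := ubnP (size t); elim: k t => // k IH t lt tm ft.
have [t1|t_gt1] := leqP (size t) 1.
  by rewrite (monic_size1 tm t1) expr1n all_divisor_sum1.
have [p [a [m' [[tE irr pm m'm pm'] [fp fm' ltm']]]]] := monic_prime_split tm t_gt1 ft.
have r_gt0 := IH m' (leq_trans ltm' lt) m'm fm'.
have lp := symbol_f_mod_values (monic_neq0 pm) fp.
have pm'2 : ~~ (p %| m' ^+ 2).
  by rewrite -irreducible_poly_coprime // coprimep_expr // irreducible_poly_coprime.
have m'2 : m' ^+ 2 \is monic by apply: monic_exp.
rewrite tE exprMn -exprM (all_divisor_sum_prime_power irr pm m'2 pm'2 _ lp).
apply: Num.Theory.mulr_gt0 => //; case: ifP => // _.
by rewrite oddM andbF.
Qed.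

(** Take b = 1 and k = 2(n + 1): the sum in [sum_all_divisor_sum] is twice
    [total_weight k], its
    terms are nonnegative and the one at t^2 is positive, where t = X f / lc(f) +
    1. *)
Lemma total_weight_gt0 k : (2 * n <= k)%N -> 0 < total_weight k.
Proof.
move=> le; have q0 i : 0 < (q ^ i)%:Z by rewrite ltz_nat expn_gt0 ltnW ?finNzRing_gt1.
have lf0 : lead_coef f != 0 by rewrite lead_coef_eq0.
suff : 0 < total_weight (2 * n.+1).
  rewrite !total_weightE //; last by rewrite leq_mul2l leqnSn.
  by rewrite !Num.Theory.pmulr_rgt0.
have le' : (2 * n <= 2 * n.+1)%N by rewrite leq_mul2l leqnSn.
pose t := ((lead_coef f)^-1 *: f) * 'X + 1.
have fm : (lead_coef f)^-1 *: f \is monic by rewrite monicE lead_coefZ mulVf.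
have szfX : size (((lead_coef f)^-1 *: f) * 'X) = n.+2.
  rewrite size_monicM ?polyX_eq0 // size_polyX size_scale ?invr_eq0 // addn2 /=.
  by rewrite /n prednK // size_poly_gt0.
have lt1 : (size (1 : {poly E})%R < size (((lead_coef f)^-1 *: f) * 'X)%R)%N.
  by rewrite szfX size_poly1.
have tm : t \is monic by rewrite monicE lead_coefDl // -monicE monicMl ?monicX.
have szt : size t = n.+2 by rewrite size_polyDl.
have ft1 : f %| t - 1 by rewrite addrK -scalerAl dvdpZr ?invr_eq0 // dvdp_mulr.
have ft : coprimep f t.
  by apply: (@coprimep_sub_dvd _ f 1); rewrite ?coprimep1 // -opprB dvdpNr.
have ft2 : f %| t ^+ 2 - 1 by rewrite subr_sqr_1 dvdp_mulr.
have t2m : t ^+ 2 \in monics E (2 * n.+1).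
  rewrite mem_monics monic_exp //= expr2 size_monicM ?monic_neq0 // szt.
  by apply/eqP; lia.
have := sum_all_divisor_sum (coprimep1 f) le'.
rewrite exprM expr2 recip_sign2 expr1n mul1r {1}/symbol_mod_f coprimep1 normp1 // quad_char1.
rewrite big_mkcond (bigD1_seq (t ^+ 2)) ?monics_uniq //= ft2 => e.
have : 0 < all_divisor_sum (t ^+ 2) by apply: all_divisor_sum_square_gt0.
have : 0 <= \sum_(i <- monics E (2 * n.+1) | i != t ^+ 2) (if f %| i - 1 then
  all_divisor_sum i else 0).
  rewrite big_seq_cond; apply: Num.Theory.sumr_ge0 => m /andP[].
  rewrite mem_monics => /andP[mm _] _; case: ifP => // fm1.
  have [] // := all_divisor_sum_structure mm (_ : coprimep f m).
  by apply: (@coprimep_sub_dvd _ f 1); rewrite ?coprimep1 // -opprB dvdpNr.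
by move: e; rewrite mulrDl mul1r; move: (all_divisor_sum _) (total_weight _) (\sum_(_ <- _
  | _) _) => x y z; lia.
Qed.

Lemma witness_exists k b : coprimep f b -> (2 * n <= k)%N ->
  recip_sign ^+ k * symbol_mod_f b = 1 ->
  exists g s w, [/\ g \is monic, f %| g * s ^+ 2 - b, coprimep g w & g %| f - w ^+ 2].
Proof.
move=> fb le kb; apply: NNPP => nw.
have := sum_all_divisor_sum fb le; rewrite kb.
rewrite big_seq_cond big1.
  by have := total_weight_gt0 le; lia.
move=> m /andP[]; rewrite mem_monics => /andP[mm _] fmb.
have fm : coprimep f m by apply: coprimep_sub_dvd fb; rewrite -opprB dvdpNr.
have [_ rs] := all_divisor_sum_structure mm fm.
apply/eqP/negPn/negP => /rs[g [s [w [mE gm gw gfw]]]]; apply: nw.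
by exists g, s, w; rewrite -mE.
Qed.

End Symbols.

(** * Finite fields *)

(** The sign c is -1 when N(alpha) is lc(f) times a square: the norm of -1 is
    (-1)^n, so the symbol of -alpha is the sign e of the reciprocity law, which is
    compensated by an odd degree k. *)
Lemma square_reflexive_finField (E : finFieldType) :
  2%:R != 0 :> E -> square_reflexive E.
Proof.
move=> E2 f f0 sf alpha ua hN.
have [f_le1|f_gt1] := leqP (size f) 1; first exact: square_reflexive_const.
have [p palpha] := to_quot_surj alpha; subst alpha.
have fp : coprimep f p by apply/is_unit_to_quot.
set n := (size f).-1.
have N1 : normp f (-1) = (-1) ^+ n.
  have [K [i [rs Df]]] := split_exists f0; apply: (fmorph_inj i).
  have szrs : size rs = n.
    have := congr1 (fun p : {poly K} => (size p).-1) Df.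
    by rewrite size_scale ?fmorph_eq0 ?lead_coef_eq0 // size_map_poly size_prod_XsubC.
  rewrite (quot_norm_poly _ f0 Df) rmorphXn !rmorphN1 -szrs.
  rewrite -(count_predT rs) -iter_mulr_1 -big_const_seq; apply: eq_bigr => r _.
  by rewrite ?rmorphN1 hornerN hornerC.
have [c c1 [g [s [w [gm gs gw gfw]]]]] : exists2 c : E, c ^+ 2 = 1 &
    exists g s w, [/\ g \is monic, f %| g * s ^+ 2 - c%:P * p, coprimep g w & g %| f - w ^+ 2].
  case: hN => [[y /is_unit_field y0 Np]|[_ [y /is_unit_field y0 ->] Np]].
    exists 1; first by rewrite expr1n.
    apply: (@witness_exists E E2 f f_gt1 sf (2 * n)); rewrite ?mul1r //.
    by rewrite exprM expr2 recip_sign2 // expr1n mul1r /symbol_mod_f fp [normp f p]Np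
      quad_char_square.
  exists (-1); first by rewrite sqrrN expr1n.
  have fNp : coprimep f (- p) by rewrite -scaleN1r coprimepZr // oppr_eq0 oner_neq0.
  apply: (@witness_exists E E2 f f_gt1 sf (2 * n).+1); rewrite ?polyCN ?mulN1r //.
  rewrite exprS exprM expr2 recip_sign2 // expr1n mulr1 /symbol_mod_f fNp -mulN1r normpM N1.
  by rewrite [normp f p]Np mulrA quad_charM // (quad_char_square E2 y0) mulr1 -/(recip_sign
    f) recip_sign2.
have c0 : c != 0 by apply: contra_eqN c1 => /eqP ->; rewrite expr0n eq_sym oner_neq0.
have g0 := monic_neq0 gm.
have cg0 : c *: g != 0 by rewrite scaler_eq0 negb_or c0.
have fcp : coprimep f (c%:P * p) by rewrite mul_polyC coprimepZr.
have fgs : coprimep f (g * s ^+ 2).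
  by apply: coprimep_sub_dvd fcp; rewrite -opprB dvdpNr.
have [fg fs] : coprimep f g /\ coprimep f s.
  by move: fgs; rewrite coprimepMr coprimep_pexpr // => /andP[].
have [u vE] : exists v, f %| s * v - 1.
  have /Bezout_eq1_coprimepP[[x y] /= e] := fs.
  exists y; have -> : s * y - 1 = - x * f by rewrite -e; ring.
  exact: dvdp_mull.
have fu : coprimep f u.
  have : coprimep f (s * u) by apply: (@coprimep_sub_dvd _ f 1);
    rewrite ?coprimep1 // -opprB dvdpNr.
  by rewrite coprimepMr => /andP[].
exists (c *: g); split=> //.
- by rewrite coprimep_sym coprimepZr.
- apply: (@reflexive_witness _ _ _ u); rewrite ?coprimepZr //.
  have -> : p * u ^+ 2 - c *: g = c *: (g * ((s * u - 1) * (s * u + 1))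
       - (g * s ^+ 2 - c%:P * p) * u ^+ 2).
    have cc : c%:P * c%:P = 1 :> {poly E} by rewrite -polyCM -expr2 c1.
    rewrite -!mul_polyC.
    have -> : p * u ^+ 2 = (c%:P * c%:P) * p * u ^+ 2 by rewrite cc mul1r.
    by ring.
  rewrite dvdpZr //; apply: dvdp_sub; last exact: dvdp_mulr.
  exact/dvdp_mull/dvdp_mulr.
apply: (@unit_square_to_quot _ _ _ w) => //; first by rewrite coprimepZl.
by rewrite dvdpZl.
Qed.

Section FiniteField.
Variables (T : Type) (cT : GRing.Field T) (s : seq (GRing.Field.Pack cT)).
Hypothesis s_all : forall x, x \in s.
Let E : fieldType := GRing.Field.Pack cT.

(** A field listed by s, with a finite structure on the same carrier and the same
    field operations, so that the result for finite field types applies by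
    conversion. *)
Definition enumerated_field : Type := T.

HB.instance Definition _ := GRing.Field.copy enumerated_field E.

Fact enumerated_axiom : Finite.axiom (undup s : seq enumerated_field).
Proof.
move=> x; rewrite count_uniq_mem ?undup_uniq // mem_undup.
by rewrite (s_all x).
Qed.

Fact enumerated_pickleK :
  pcancel (fun x : enumerated_field => index (x : E) s)
          (fun i => Some (nth (0 : E) s i : enumerated_field)).
Proof. by move=> x /=; congr Some; apply: nth_index; apply: s_all. Qed.

HB.instance Definition _ := isCountable.Build enumerated_field enumerated_pickleK.

HB.instance Definition _ := isFinite.Build enumerated_field enumerated_axiom.

Lemma square_reflexive_finite_field : 2%:R != 0 :> E -> square_reflexive E.
Proof. exact: (@square_reflexive_finField (enumerated_field : finFieldType)). Qed.

End FiniteField.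

Theorem theoremB (E : fieldType) (charE : 2%N \notin [pchar E]%R)
    (hE : finite_field E \/ pseudo_algebraically_closed E) :
  square_reflexive E.
Proof.
have E2 : 2%:R != 0 :> E by apply: contra charE => e; rewrite inE.
case: hE => [fin|pac]; last exact: PAC_square_reflexive.
case: E fin E2 {charE} => T cT [s s_all]; exact: square_reflexive_finite_field s_all.
Qed.
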